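(* For every $\varepsilon>0$ and every $k\in\mathbb{N}$ there exists $n\in\mathbb{N}$ such that the set $\{\mu\in\mathfrak{O}:|\mu|^2=n\}$ has more than $k$ elements, and every such $\mu$ lies on one of the six arcs $\{\sqrt n\,e^{i(\nu\pi/3+\varphi)}: |\varphi|<\varepsilon\}$, $\nu=0,1,\dots,5$.
   Context: $\omega=e^{i\pi/3}$ and $\mathfrak{O}=\mathbb{Z}[\omega]\subset\mathbb{C}$ (the hexagonal lattice). *)

(* Defs.v *)
From Stdlib Require Import Reals ZArith List.
From Coquelicot Require Import Coquelicot.
Open Scope R_scope.

Definition omega : C := (cos (PI / 3), sin (PI / 3)).

Definition in_O (z : C) : Prop :=
  exists a b : Z, z = Cplus (RtoC (IZR a)) (Cmult (RtoC (IZR b)) omega).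

Definition cis (t : R) : C := (cos t, sin t).

Definition on_six_arcs (eps : R) (n : nat) (z : C) : Prop :=
  exists nu : nat, (nu <= 5)%nat /\
    exists phi : R, Rabs phi < eps /\
      z = Cmult (RtoC (sqrt (INR n))) (cis (INR nu * PI / 3 + phi)).

(* Main.v *)
(** A prime [p] of [Z[omega]] with argument [theta] gives the lattice points [u p^a conj(p)^b] of
    norm [N(p)^k], where [u] is a unit and [a + b = k], and there are no others; their arguments
    are [(a - b) theta] modulo [pi / 3]. So it suffices to find a prime whose argument is nonzero
    and arbitrarily small.

    Let [chi(x) = (x / |x|)^6]. For [m >= 1] the series [L_m(s)] of [chi^m(x) N(x)^(-s)] stays
    bounded as [s -> 1+]: writing [y = b x + j] with [j] running over residues modulo [b], and
    replacing [b x + j] by [b x], costs [O(|x|^(-3))] per term, so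
    [L_m(s) = c chi^m(b) L_m(s) + O(1)] with [c] real, while [chi^m(b)] is not real for
    [b = 2 + omega]. Meanwhile [L_0(s) -> oo]. By the Euler product (applied to a finite set [P]
    of primes, after which essentially only the six units remain), the sums of
    [Re chi^m(p) N(p)^(-s)] over [P] are bounded above for [m >= 1] while the sums of [N(p)^(-s)]
    are not bounded.

    Upper bounds alone are enough, and nonvanishing of [L_m(1)] is not needed: with
    [g(x) = (2 + 2 cos x)^n], the coefficients of the cosine polynomial [- g'' - g] are nonnegative
    except for a constant term which is negative, of order [4^n] up to a power of [n]. This
    polynomial is nonnegative at [0] and exponentially smaller than [4^n] away from [0]. If no
    prime had a small nonzero argument, averaging it over [P] would contradict these bounds. *)
Require Import Defs.
From Stdlib Require Import Reals ZArith List Permutation Lra Lia ClassicalEpsilon.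
From Coquelicot Require Import Coquelicot Iter.
Open Scope R_scope.

(** * Unordered sums *)

Definition lsum {G : AbelianMonoid} {T : Type} (f : T -> G) (l : list T) : G :=
  iter plus zero l f.

Section AbelianMonoidSums.

Context {G : AbelianMonoid} {T : Type}.

Lemma lsum_cons (f : T -> G) x l : lsum f (x :: l) = plus (f x) (lsum f l).
Proof. reflexivity. Qed.

Lemma lsum_app (f : T -> G) l l' : lsum f (l ++ l') = plus (lsum f l) (lsum f l').
Proof. apply iter_cat; [apply plus_zero_l | apply plus_assoc]. Qed.

Lemma lsum_ext (f g : T -> G) l : (forall x, In x l -> f x = g x) -> lsum f l = lsum g l.
Proof. apply iter_ext. Qed.

Lemma lsum_map {U : Type} (f : T -> G) (h : U -> T) l :
  lsum f (map h l) = lsum (fun x => f (h x)) l.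
Proof. induction l as [|x l IH]; [reflexivity|]. exact (f_equal (plus _) IH). Qed.

Lemma lsum_zero (f : T -> G) l : (forall x, In x l -> f x = zero) -> lsum f l = zero.
Proof.
  induction l as [|x l IH]; intros H; [reflexivity|].
  rewrite lsum_cons, IH, (H x); [apply plus_zero_l | left; auto |].
  intros y Hy. apply H. right; auto.
Qed.

Lemma lsum_plus (f g : T -> G) l :
  lsum (fun x => plus (f x) (g x)) l = plus (lsum f l) (lsum g l).
Proof.
  induction l as [|x l IH]; [symmetry; apply plus_zero_l|].
  rewrite !lsum_cons, IH, <- !plus_assoc. f_equal. rewrite !plus_assoc. f_equal. apply plus_comm.
Qed.

Lemma lsum_perm (f : T -> G) l l' : Permutation l l' -> lsum f l = lsum f l'.
Proof.
  induction 1 as [|x l l' _ IH|x y l|]; try congruence.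
  - exact (f_equal (plus _) IH).
  - rewrite !lsum_cons, !plus_assoc. f_equal. apply plus_comm.
Qed.

Lemma lsum_single (f : T -> G) l j :
  NoDup l -> In j l -> (forall i, In i l -> i <> j -> f i = zero) -> lsum f l = f j.
Proof.
  intros Nl Hj f_zero. apply in_split in Hj as (u & v & ->).
  rewrite <- (lsum_perm f _ _ (Permutation_middle u v j)).
  rewrite lsum_cons, lsum_zero; [apply plus_zero_r|]. intros i Hi. apply f_zero.
  - apply in_app_or in Hi. apply in_or_app. simpl. tauto.
  - intros ->. exact (NoDup_remove_2 _ _ _ Nl Hi).
Qed.

End AbelianMonoidSums.

Lemma lsum_scal {K : Ring} {V : ModuleSpace K} {T} (c : K) (f : T -> V) l :
  lsum (fun x => scal c (f x)) l = scal c (lsum f l).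
Proof.
  induction l as [|x l IH]; [symmetry; apply scal_zero_r|].
  rewrite !lsum_cons, IH. symmetry. apply (scal_distr_l c).
Qed.

Lemma norm_lsum_le {K : AbsRing} {V : NormedModule K} {T} (f : T -> V) l :
  norm (lsum f l) <= lsum (fun x => norm (f x)) l.
Proof.
  induction l as [|x l IH]; [right; apply (norm_zero (V := V))|].
  eapply Rle_trans; [apply (norm_triangle (f x) (lsum f l))|].
  apply Rplus_le_compat_l, IH.
Qed.

Section RealSums.

Context {T : Type}.
Implicit Types f g : T -> R.

Lemma lsum_Rcons f x l : lsum f (x :: l) = f x + lsum f l.
Proof. reflexivity. Qed.

Lemma lsum_Rapp f l l' : lsum f (l ++ l') = lsum f l + lsum f l'.
Proof. exact (lsum_app f l l'). Qed.

Lemma lsum_Rplus f g l : lsum (fun x => f x + g x) l = lsum f l + lsum g l.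
Proof. exact (lsum_plus f g l). Qed.

Lemma lsum_Rmult_l (c : R) f l : lsum (fun x => c * f x) l = c * lsum f l.
Proof. exact (lsum_scal (V := R_ModuleSpace) c f l). Qed.

Lemma lsum_Rconst (c : R) (l : list T) : lsum (fun _ => c) l = INR (length l) * c.
Proof. apply iter_const. Qed.

Lemma lsum_le f g l : (forall x, In x l -> f x <= g x) -> lsum f l <= lsum g l.
Proof.
  induction l as [|x l IH]; intros H; [apply Rle_refl|].
  apply Rplus_le_compat; [apply H; left; auto | apply IH; intros; apply H; right; auto].
Qed.

Lemma lsum_nonneg f l : (forall x, In x l -> 0 <= f x) -> 0 <= lsum f l.
Proof.
  intros H. apply Rle_trans with (lsum (fun _ : T => 0) l); [|apply lsum_le, H].
  right. symmetry. apply (lsum_zero (fun _ : T => 0)). auto.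
Qed.

Lemma RtoC_lsum f l : RtoC (lsum f l) = lsum (fun x => RtoC (f x)) l.
Proof.
  induction l as [|x l IH]; [reflexivity|].
  rewrite lsum_Rcons, RtoC_plus, IH. reflexivity.
Qed.

End RealSums.

Lemma lsum_list_prod {T U} (f : T -> R) (g : U -> R) A B :
  lsum (fun p => f (fst p) * g (snd p)) (list_prod A B) = lsum f A * lsum g B.
Proof.
  induction A as [|a A IH]; [symmetry; apply Rmult_0_l|].
  simpl list_prod. rewrite lsum_Rapp, lsum_map, IH, lsum_Rcons. simpl.
  rewrite lsum_Rmult_l. ring.
Qed.

Section ListSets.

Context {T : Type}.

Lemma classical_eq_dec (x y : T) : {x = y} + {x <> y}.
Proof. apply excluded_middle_informative. Qed.

Lemma NoDup_incl_split (l0 l : list T) :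
  NoDup l0 -> NoDup l -> incl l0 l ->
  exists l1, Permutation l (l0 ++ l1) /\ NoDup l1 /\ (forall x, In x l1 -> ~ In x l0).
Proof.
  intros N0 Nl Hi.
  pose (outside := fun x => if in_dec classical_eq_dec x l0 then false else true).
  assert (outside_iff : forall x, outside x = true <-> ~ In x l0).
  { intros x. unfold outside. destruct in_dec; split; intros; congruence || tauto. }
  exists (filter outside l).
  assert (disjoint : forall x, In x (filter outside l) -> ~ In x l0).
  { intros x Hx. apply filter_In in Hx as [_ Hx]. apply outside_iff; auto. }
  assert (N1 : NoDup (filter outside l)) by (apply NoDup_filter; auto).
  split; [|split]; auto.
  apply NoDup_Permutation; auto.
  - apply NoDup_app; auto. intros x Hx Hx1. exact (disjoint x Hx1 Hx).
  - intros x. rewrite in_app_iff, filter_In, outside_iff.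
    destruct (classic (In x l0)) as [Hx|Hx]; [|tauto]. pose proof (Hi x Hx). tauto.
Qed.

Lemma lsum_incl (f : T -> R) l l' :
  (forall x, 0 <= f x) -> NoDup l -> incl l l' -> lsum f l <= lsum f l'.
Proof.
  intros Hf Nl. revert l'. induction Nl as [|x l Hx Nl IH]; intros l' Hi.
  - apply lsum_nonneg; auto.
  - destruct (in_split x l' (Hi x (or_introl eq_refl))) as (u & v & ->).
    rewrite <- (lsum_perm f _ _ (Permutation_middle u v x)), !lsum_Rcons.
    apply Rplus_le_compat_l, IH. intros y Hy.
    destruct (in_elt_inv y x u v (Hi y (or_intror Hy))) as [->|]; [contradiction | auto].
Qed.

Lemma maximal_independent_sublist (R : T -> T -> Prop) (l : list T) :
  (forall x, R x x) ->
  exists J, incl J l /\ ForallOrdPairs (fun x j => ~ R j x) J /\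
    forall x, In x l -> exists j, In j J /\ R j x.
Proof.
  intros Hrefl. induction l as [|x l (J & Hi & HJ & HC)].
  - exists nil. split; [intros x []|]. split; [constructor | intros x []].
  - destruct (classic (exists j, In j J /\ R j x)) as [D|D].
    + exists J. split; [apply incl_tl; auto|]. split; auto.
      intros y [<-|Hy]; auto.
    + exists (x :: J). split; [|split].
      * apply incl_cons; [left; auto | apply incl_tl; auto].
      * constructor; auto. apply Forall_forall. intros j Hj Hr. apply D; eauto.
      * intros y [<-|Hy]; [exists x; simpl; auto|].
        destruct (HC y Hy) as (j & Hj & Hr). exists j; simpl; auto.
Qed.

End ListSets.

Definition finite_subsets {T : Type} (Q : list T -> Prop) : Prop :=
  exists l0, forall l, NoDup l -> incl l0 l -> Q l.

Global Instance finite_subsets_filter {T} : ProperFilter (@finite_subsets T).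
Proof.
  constructor.
  - intros Q (l0 & H). exists (nodup classical_eq_dec l0).
    apply H; [apply NoDup_nodup | apply nodup_incl, incl_refl].
  - constructor.
    + exists nil; auto.
    + intros P Q (l1 & H1) (l2 & H2). exists (l1 ++ l2). intros l Nl Hi.
      apply incl_app_inv in Hi as [I1 I2]. auto.
    + intros P Q HPQ (l0 & H). exists l0; auto.
Qed.

Lemma finite_subsets_superset {T} (l0 : list T) :
  finite_subsets (fun l => NoDup l /\ incl l0 l).
Proof. exists l0; auto. Qed.

Lemma minus_plus_cancel_l {G : AbelianGroup} (x y : G) : minus (plus x y) x = y.
Proof.
  rewrite plus_comm. unfold minus. rewrite <- plus_assoc.
  transitivity (plus y zero); [apply f_equal, plus_opp_r | apply plus_zero_r].
Qed.

Section HasSum.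

Context {K : AbsRing} {V : NormedModule K} {T : Type}.
Implicit Types (f g : T -> V) (L M : V).

Definition has_sum (f : T -> V) (L : V) : Prop := filterlim (lsum f) finite_subsets (locally L).

Lemma has_sum_ext f g L : (forall x, f x = g x) -> has_sum f L -> has_sum g L.
Proof. intros E. apply filterlim_ext. intros l. apply lsum_ext; auto. Qed.

Lemma has_sum_zero : has_sum (fun _ => zero) zero.
Proof.
  apply (filterlim_ext (fun _ => zero)); [|apply filterlim_const].
  intros l. symmetry. apply lsum_zero; auto.
Qed.

Lemma has_sum_plus f g L M :
  has_sum f L -> has_sum g M -> has_sum (fun x => plus (f x) (g x)) (plus L M).
Proof.
  intros Hf Hg.
  apply (filterlim_ext (fun l => plus (lsum f l) (lsum g l))).
  - intros l. symmetry. apply lsum_plus.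
  - eapply filterlim_comp_2; [apply Hf | apply Hg | apply filterlim_plus].
Qed.

Lemma has_sum_scal (c : K) f L : has_sum f L -> has_sum (fun x => scal c (f x)) (scal c L).
Proof.
  intros Hf. apply (filterlim_ext (fun l => scal c (lsum f l))).
  - intros l. symmetry. exact (lsum_scal (V := V) c f l).
  - eapply filterlim_comp; [apply Hf | apply filterlim_scal_r].
Qed.

Lemma has_sum_minus f g L M :
  has_sum f L -> has_sum g M -> has_sum (fun x => minus (f x) (g x)) (minus L M).
Proof.
  intros Hf Hg. apply has_sum_plus; auto.
  replace (opp M) with (scal (opp one) M) by exact (scal_opp_one (V := V) M).
  apply (has_sum_ext (fun x => scal (opp one) (g x))); [|apply has_sum_scal; auto].
  intros x. exact (scal_opp_one (V := V) (g x)).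
Qed.

Lemma has_sum_unique f L M : has_sum f L -> has_sum f M -> L = M.
Proof. apply filterlim_locally_unique. Qed.

Lemma has_sum_norm_lower f L B :
  has_sum f L -> finite_subsets (fun l => B <= norm (lsum f l)) -> B <= norm L.
Proof.
  intros H Hb. change (Rbar_le B (norm L)).
  apply (filterlim_le (F := finite_subsets) (fun _ => B) (fun l => norm (lsum f l))); auto.
  - apply filterlim_const.
  - exact (filterlim_comp _ _ _ _ _ _ _ _ H (filterlim_norm L)).
Qed.

Lemma has_sum_tail f L B l0 :
  NoDup l0 -> has_sum f L ->
  (forall l, NoDup l -> (forall x, In x l -> ~ In x l0) -> norm (lsum f l) <= B) ->
  norm (minus L (lsum f l0)) <= B.
Proof.
  intros N0 H bound. change (Rbar_le (norm (minus L (lsum f l0))) B).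
  apply (filterlim_le (F := finite_subsets)
    (fun l => norm (minus (lsum f l) (lsum f l0))) (fun _ => B)).
  - generalize (finite_subsets_superset l0). apply filter_imp. intros l [Nl Hi].
    destruct (NoDup_incl_split l0 l) as (l1 & perm_l & N1 & disjoint); auto.
    rewrite (lsum_perm f _ _ perm_l), lsum_app.
    apply Rle_trans with (norm (lsum f l1)); [right | auto].
    exact (f_equal norm (minus_plus_cancel_l (G := V) _ _)).
  - apply (filterlim_comp _ _ _ (fun l => minus (lsum f l) (lsum f l0)) norm
      _ (locally (minus L (lsum f l0)))); [|apply (filterlim_norm (minus L (lsum f l0)))].
    exact (filterlim_comp_2 (lsum f) (fun _ => opp (lsum f l0)) plus
      H (filterlim_const _) (filterlim_plus L (opp (lsum f l0)))).
  - apply filterlim_const.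
Qed.

Lemma has_sum_norm_le f (F : T -> R) L B :
  has_sum f L -> (forall x, norm (f x) <= F x) ->
  (forall l, NoDup l -> lsum F l <= B) -> norm L <= B.
Proof.
  intros H dominated bound.
  replace L with (minus L (lsum f nil)) by exact (minus_zero_r (G := V) L).
  apply has_sum_tail; auto; [constructor|].
  intros l Nl _. eapply Rle_trans; [apply norm_lsum_le|].
  eapply Rle_trans; [|apply (bound l Nl)]. apply lsum_le; auto.
Qed.

End HasSum.

Lemma lsum_le_Cmod_sum {T} (F : T -> R) (L : C) l :
  (forall x, 0 <= F x) -> has_sum (fun x => RtoC (F x)) L -> NoDup l -> lsum F l <= Cmod L.
Proof.
  intros HF HL Nl. apply (has_sum_norm_lower _ _ _ HL). exists l. intros l' Nl' Hi.
  change (lsum F l <= Cmod (lsum (fun x => RtoC (F x)) l')).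
  rewrite <- RtoC_lsum, Cmod_R. eapply Rle_trans; [|apply Rle_abs].
  apply lsum_incl; auto.
Qed.

Definition summable {T : Type} (F : T -> R) : Prop :=
  (forall x, 0 <= F x) /\ exists B, forall l, NoDup l -> lsum F l <= B.

Section Summable.

Context {T : Type}.
Implicit Types F G : T -> R.

Lemma summable_le F G : (forall x, 0 <= F x <= G x) -> summable G -> summable F.
Proof.
  intros H (_ & B & HB). split; [apply H|]. exists B. intros l Nl.
  eapply Rle_trans; [|apply (HB l Nl)]. apply lsum_le. intros; apply H.
Qed.

Lemma summable_scal c F : 0 <= c -> summable F -> summable (fun x => c * F x).
Proof.
  intros Hc (HF & B & HB). split; [intros; apply Rmult_le_pos; auto|].
  exists (c * B). intros l Nl. rewrite lsum_Rmult_l. apply Rmult_le_compat_l; auto.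
Qed.

Lemma summable_comp {U : Type} (h : U -> T) F :
  FinFun.Injective h -> summable F -> summable (fun x => F (h x)).
Proof.
  intros Hh (HF & B & HB). split; auto. exists B. intros l Nl. rewrite <- lsum_map.
  apply HB, FinFun.Injective_map_NoDup; auto.
Qed.

Lemma summable_tail F e : summable F -> 0 < e ->
  exists l0, NoDup l0 /\ forall l, NoDup l -> (forall x, In x l -> ~ In x l0) -> lsum F l <= e.
Proof.
  intros (HF & B & HB) He.
  destruct (completeness (fun x => exists l, NoDup l /\ x = lsum F l)) as (s & U & S).
  - exists B. intros x (l & Nl & ->). auto.
  - exists 0, nil. split; [constructor | reflexivity].
  - apply NNPP. intros Hno. assert (s <= s - e); [|lra].
    apply S. intros x (l0 & N0 & ->). apply Rnot_lt_le. intros Hlt.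
    apply Hno. exists l0. split; auto. intros l Nl D.
    assert (lsum F (l ++ l0) <= s) as H.
    { apply U. exists (l ++ l0). split; [apply NoDup_app|]; auto. }
    rewrite lsum_Rapp in H. lra.
Qed.

Lemma summable_has_sum {K : AbsRing} {V : CompleteNormedModule K} (f : T -> V) F :
  (forall x, norm (f x) <= F x) -> summable F -> exists L, has_sum f L.
Proof.
  intros dominated HF. apply (filterlim_locally_cauchy (U := V) (F := finite_subsets) (lsum f)).
  intros [e He]. destruct (summable_tail F (e / 3) HF) as (l0 & N0 & small_tail); [lra|].
  assert (near : forall l, NoDup l -> incl l0 l -> ball (lsum f l0 : V) (e / 2) (lsum f l)).
  { intros l Nl Hi. destruct (NoDup_incl_split l0 l) as (l1 & perm_l & N1 & disjoint); auto.
    apply (norm_compat1 (V := V)). rewrite (lsum_perm f _ _ perm_l), lsum_app.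
    apply Rle_lt_trans with (norm (lsum f l1)).
    - right. exact (f_equal norm (minus_plus_cancel_l (G := V) _ _)).
    - eapply Rle_lt_trans; [apply (norm_lsum_le (V := V))|].
      apply Rle_lt_trans with (e / 3); [|lra].
      eapply Rle_trans; [apply lsum_le; intros; apply dominated | apply small_tail; auto]. }
  exists (fun l => NoDup l /\ incl l0 l). split; [apply finite_subsets_superset|].
  intros u v [Nu Iu] [Nv Iv]. simpl. replace e with (e / 2 + e / 2) by field.
  apply ball_triangle with (lsum f l0); [apply ball_sym|]; apply near; auto.
Qed.

End Summable.

Definition restrict {T : Type} {G : AbelianMonoid} (Q : T -> Prop) (f : T -> G) (x : T) : G :=
  if excluded_middle_informative (Q x) then f x else zero.

Lemma restrict_in {T} {G : AbelianMonoid} (Q : T -> Prop) (f : T -> G) x :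
  Q x -> restrict Q f x = f x.
Proof. intros H. unfold restrict. destruct excluded_middle_informative; tauto. Qed.

Lemma restrict_out {T} {G : AbelianMonoid} (Q : T -> Prop) (f : T -> G) x :
  ~ Q x -> restrict Q f x = zero.
Proof. intros H. unfold restrict. destruct excluded_middle_informative; tauto. Qed.

Lemma lsum_restrict_image {T U} {G : AbelianMonoid} (h : T -> U) (f : U -> G) (l : list U) :
  FinFun.Injective h -> NoDup l ->
  exists l', NoDup l' /\ (forall x, In x l' <-> In (h x) l) /\
    lsum (restrict (fun u => exists x, u = h x) f) l = lsum (fun x => f (h x)) l'.
Proof.
  intros Hh Nl. induction Nl as [|u l Hu Nl (l' & N' & I' & S')].
  - exists nil. split; [constructor|]. split; [tauto | reflexivity].
  - destruct (classic (exists x, u = h x)) as [(x & ->)|Hn].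
    + exists (x :: l'). split; [|split].
      * constructor; auto. rewrite I'; auto.
      * intros y. simpl. rewrite I'. split; intros [E|E]; auto. left; congruence.
      * rewrite !lsum_cons, S', restrict_in; eauto.
    + exists l'. split; [|split]; auto.
      * intros y. simpl. rewrite I'. split; auto. intros [E|E]; auto.
        exfalso. apply Hn. eauto.
      * rewrite lsum_cons, S', restrict_out; auto. apply plus_zero_l.
Qed.

Lemma has_sum_image {T U} {K : AbsRing} {V : NormedModule K} (h : T -> U) (f : U -> V) L :
  FinFun.Injective h -> has_sum (fun x => f (h x)) L ->
  has_sum (restrict (fun u => exists x, u = h x) f) L.
Proof.
  intros Hh H Q HQ. destruct (H Q HQ) as (l0 & near). exists (map h l0). intros l Nl Hi.
  destruct (lsum_restrict_image h f l Hh Nl) as (l' & N' & I' & E).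
  rewrite E. apply near; auto. intros x Hx. apply I', Hi, in_map; auto.
Qed.

(** * Arithmetic of Eisenstein integers *)

(* The pair [(a, b)] stands for [a + b omega]; recall [omega ^ 2 = omega - 1]. *)
Definition eisenstein : Type := (Z * Z)%type.

Declare Scope eis_scope.
Delimit Scope eis_scope with E.
Bind Scope eis_scope with eisenstein.

Definition e0 : eisenstein := (0, 0)%Z.
Definition e1 : eisenstein := (1, 0)%Z.
Definition eomega : eisenstein := (0, 1)%Z.
Definition eadd (x y : eisenstein) : eisenstein := (fst x + fst y, snd x + snd y)%Z.
Definition eopp (x : eisenstein) : eisenstein := (- fst x, - snd x)%Z.
Definition esub (x y : eisenstein) : eisenstein := eadd x (eopp y).
Definition emul (x y : eisenstein) : eisenstein :=
  (fst x * fst y - snd x * snd y, fst x * snd y + snd x * fst y + snd x * snd y)%Z.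
Definition econj (x : eisenstein) : eisenstein := (fst x + snd x, - snd x)%Z.
Definition enorm (x : eisenstein) : Z := (fst x * fst x + fst x * snd x + snd x * snd x)%Z.

Fixpoint epow (x : eisenstein) (n : nat) : eisenstein :=
  match n with O => e1 | S n' => emul x (epow x n') end.

Notation "0" := e0 : eis_scope.
Notation "1" := e1 : eis_scope.
Infix "+" := eadd : eis_scope.
Infix "-" := esub : eis_scope.
Infix "*" := emul : eis_scope.
Infix "^" := epow : eis_scope.

Definition edvd (x y : eisenstein) : Prop := exists z, y = (x * z)%E.

Definition eprime (p : eisenstein) : Prop :=
  p <> 0%E /\ enorm p <> 1%Z /\ forall x y, edvd p (x * y) -> edvd p x \/ edvd p y.

Ltac eisenstein_ring :=
  intros; repeat match goal with x : eisenstein |- _ => destruct x end;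
  unfold e0, e1, esub, eadd, eopp, emul, econj, enorm in *; cbn [fst snd];
  try apply f_equal2; ring.

Lemma eisenstein_ring_theory : ring_theory e0 e1 eadd emul esub eopp eq.
Proof. constructor; eisenstein_ring. Qed.

Add Ring eisenstein : eisenstein_ring_theory.

Lemma enorm_mul x y : enorm (x * y) = (enorm x * enorm y)%Z.
Proof. eisenstein_ring. Qed.

Lemma enorm_conj x : enorm (econj x) = enorm x.
Proof. eisenstein_ring. Qed.

Lemma emul_conj x : (x * econj x)%E = (enorm x, 0%Z).
Proof. eisenstein_ring. Qed.

Lemma econj_mul x y : econj (x * y) = (econj x * econj y)%E.
Proof. eisenstein_ring. Qed.

Lemma econj_involutive x : econj (econj x) = x.
Proof. eisenstein_ring. Qed.

Lemma four_enorm x :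
  (4 * enorm x = (2 * fst x + snd x) * (2 * fst x + snd x) + 3 * (snd x * snd x))%Z.
Proof. eisenstein_ring. Qed.

Lemma enorm_nonneg x : (0 <= enorm x)%Z.
Proof.
  pose proof (four_enorm x). pose proof (Z.square_nonneg (2 * fst x + snd x)).
  pose proof (Z.square_nonneg (snd x)). lia.
Qed.

Lemma enorm_eq_0 x : enorm x = 0%Z -> x = 0%E.
Proof.
  intros H. pose proof (four_enorm x) as four. rewrite H in four.
  destruct x as [a b]; cbn [fst snd] in four.
  pose proof (Z.square_nonneg (2 * a + b)). pose proof (Z.square_nonneg b).
  assert (b = 0)%Z by nia. subst b. assert (a = 0)%Z by nia. subst a. reflexivity.
Qed.

Lemma enorm_pos x : x <> 0%E -> (0 < enorm x)%Z.
Proof.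
  intros H. pose proof (enorm_nonneg x). assert (enorm x <> 0%Z); [|lia].
  intros E0. apply H, enorm_eq_0, E0.
Qed.

Lemma emul_eq_0 x y : (x * y)%E = 0%E -> x = 0%E \/ y = 0%E.
Proof.
  intros H. apply (f_equal enorm) in H. rewrite enorm_mul in H.
  apply Z.mul_eq_0 in H as [H|H]; apply enorm_eq_0 in H; auto.
Qed.

Lemma esub_eq_0 x y : (x - y)%E = 0%E -> x = y.
Proof. intros H. replace x with ((x - y) + y)%E by ring. rewrite H. ring. Qed.

Lemma emul_cancel_l x y z : x <> 0%E -> (x * y = x * z)%E -> y = z.
Proof.
  intros Hx H. apply esub_eq_0.
  destruct (emul_eq_0 x (y - z)) as [H0|H0]; [|tauto|auto].
  replace (x * (y - z))%E with (x * y - x * z)%E by ring. rewrite H. ring.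
Qed.

Lemma affine_injective b j : b <> 0%E -> FinFun.Injective (fun x => b * x + j)%E.
Proof.
  intros Hb x y E. apply (emul_cancel_l b); auto.
  replace (b * x)%E with (b * x + j - j)%E by ring. rewrite E. ring.
Qed.

Definition eunits : list eisenstein := map (epow eomega) (seq 0 6).

Lemma enorm_1_iff x : enorm x = 1%Z <-> In x eunits.
Proof.
  split.
  - intros H. pose proof (four_enorm x) as four. rewrite H in four.
    destruct x as [a b]; cbn [fst snd] in four.
    pose proof (Z.square_nonneg (2 * a + b)).
    assert (-1 <= b <= 1)%Z by nia. assert (-1 <= a <= 1)%Z by nia.
    assert (b = -1 \/ b = 0 \/ b = 1)%Z as Hb by lia.
    assert (a = -1 \/ a = 0 \/ a = 1)%Z as Ha by lia.
    destruct Ha as [->|[->| ->]], Hb as [->|[->| ->]];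
      unfold enorm in H; simpl in H; try lia; simpl; tauto.
  - simpl. intros [<-|[<-|[<-|[<-|[<-|[<-|[]]]]]]]; reflexivity.
Qed.

Lemma eunits_NoDup : NoDup eunits.
Proof. repeat constructor; simpl; intuition discriminate. Qed.

Lemma unit_pow_6 u : enorm u = 1%Z -> (u ^ 6)%E = 1%E.
Proof. rewrite enorm_1_iff. simpl. intros [<-|[<-|[<-|[<-|[<-|[<-|[]]]]]]]; reflexivity. Qed.

Lemma edvd_refl x : edvd x x.
Proof. exists 1%E. ring. Qed.

Lemma edvd_trans x y z : edvd x y -> edvd y z -> edvd x z.
Proof. intros (u & ->) (v & ->). exists (u * v)%E. ring. Qed.

Lemma edvd_mul_l x y z : edvd x z -> edvd x (y * z).
Proof. intros (u & ->). exists (y * u)%E. ring. Qed.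

Lemma edvd_add x y z : edvd x y -> edvd x z -> edvd x (y + z).
Proof. intros (u & ->) (v & ->). exists (u + v)%E. ring. Qed.

Lemma emul_conj_unit u x : enorm u = 1%Z -> (econj u * (u * x))%E = x.
Proof.
  intros H. replace (econj u * (u * x))%E with (u * econj u * x)%E by ring.
  rewrite emul_conj, H. change ((1, 0)%Z : eisenstein) with e1. ring.
Qed.

Lemma edvd_unit_mul u x y : enorm u = 1%Z -> edvd x (u * y) <-> edvd x y.
Proof.
  intros H. split; [|apply edvd_mul_l].
  intros D. rewrite <- (emul_conj_unit u y H). apply edvd_mul_l, D.
Qed.

Lemma edvd_antisym_enorm d p : p <> 0%E -> edvd d p -> (enorm p <= enorm d)%Z -> edvd p d.
Proof.
  intros p_neq_0 (e & ->) Hle. pose proof (enorm_pos _ p_neq_0) as Np. rewrite enorm_mul in *.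
  pose proof (enorm_nonneg d). pose proof (enorm_nonneg e).
  assert (enorm e = 1%Z) as Ue by nia.
  exists (econj e). rewrite <- (emul_conj_unit e d Ue) at 1. ring.
Qed.

Lemma nearest_multiple (x n : Z) : (0 < n)%Z -> exists q, (-n <= 2 * (x - n * q) <= n)%Z.
Proof.
  intros Hn. exists ((2 * x + n) / (2 * n))%Z.
  pose proof (Z.div_mod (2 * x + n) (2 * n)). pose proof (Z.mod_pos_bound (2 * x + n) (2 * n)).
  lia.
Qed.

Lemma euclidean_division x y : y <> 0%E -> exists q, (enorm (x - y * q) < enorm y)%Z.
Proof.
  intros Hy. pose proof (enorm_pos y Hy) as Hn.
  destruct (nearest_multiple (fst (x * econj y)%E) (enorm y) Hn) as (q1 & Hq1).
  destruct (nearest_multiple (snd (x * econj y)%E) (enorm y) Hn) as (q2 & Hq2).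
  exists (q1, q2).
  assert (enorm y * enorm (x - y * (q1, q2)) =
    enorm (fst (x * econj y)%E - enorm y * q1, snd (x * econj y)%E - enorm y * q2)%Z)%Z as scaled.
  { clear. eisenstein_ring. }
  set (u := (fst (x * econj y)%E - enorm y * q1)%Z) in *.
  set (v := (snd (x * econj y)%E - enorm y * q2)%Z) in *.
  assert (enorm (u, v) < enorm y * enorm y)%Z.
  { unfold enorm at 1; cbn [fst snd].
    pose proof (Z.mul_nonneg_nonneg (enorm y - 2 * u) (enorm y + 2 * u)).
    pose proof (Z.mul_nonneg_nonneg (enorm y - 2 * v) (enorm y + 2 * v)).
    pose proof (Z.square_nonneg (u - v)). nia. }
  nia.
Qed.

Lemma enorm_minimal (Q : eisenstein -> Prop) :
  (exists x, Q x) -> exists x, Q x /\ forall y, Q y -> (enorm x <= enorm y)%Z.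
Proof.
  intros (x & Hx).
  induction x as [x IH]
    using (well_founded_ind (well_founded_ltof _ (fun x => Z.to_nat (enorm x)))).
  destruct (classic (exists y, Q y /\ (enorm y < enorm x)%Z)) as [(y & Hy & L)|H].
  - apply (IH y); auto. unfold ltof. pose proof (enorm_nonneg y). lia.
  - exists x; split; auto. intros y Hy. apply Znot_gt_le. intros G.
    apply H. exists y; split; auto; lia.
Qed.

Lemma bezout a b : a <> 0%E ->
  exists d s t, d = (s * a + t * b)%E /\ edvd d a /\ edvd d b.
Proof.
  intros Ha.
  destruct (enorm_minimal (fun d => d <> 0%E /\ exists s t, d = (s * a + t * b)%E))
    as (d & (d_neq_0 & s & t & Ed) & minimal).
  { exists a; split; auto. exists 1%E, 0%E. ring. }
  assert (forall s' t', edvd d (s' * a + t' * b)) as divides.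
  { intros s' t'. destruct (euclidean_division (s' * a + t' * b) d d_neq_0) as (q & Hq).
    exists q. apply NNPP. intros Hne. apply (Zlt_not_le _ _ Hq), minimal. split.
    - intros H. apply Hne, esub_eq_0, H.
    - exists (s' - s * q)%E, (t' - t * q)%E. rewrite Ed. ring. }
  exists d, s, t. split; auto. split.
  - replace a with (1 * a + 0 * b)%E by ring. apply divides.
  - replace b with (0 * a + 1 * b)%E by ring. apply divides.
Qed.

(* A nonunit divisor of least norm is prime: by minimality, its gcd with any
   element it does not divide is a unit. *)
Lemma exists_prime_divisor x : x <> 0%E -> enorm x <> 1%Z -> exists p, eprime p /\ edvd p x.
Proof.
  intros Hx Hu.
  destruct (enorm_minimal (fun p => edvd p x /\ enorm p <> 1%Z))
    as (p & (p_dvd & p_nonunit) & minimal).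
  { exists x; split; auto. apply edvd_refl. }
  assert (p <> 0%E) as p_neq_0.
  { intros ->. destruct p_dvd as (z & ->). apply Hx. ring. }
  exists p; split; auto. split; auto. split; auto.
  intros a b Hab. destruct (classic (edvd p a)) as [|Ha]; [auto|right].
  destruct (bezout p a p_neq_0) as (d & s & t & Ed & Ddp & Dda).
  destruct (Z.eq_dec (enorm d) 1) as [U|U].
  - apply (edvd_unit_mul d); auto.
    replace (d * b)%E with (s * b * p + t * (a * b))%E by (rewrite Ed; ring).
    apply edvd_add; apply edvd_mul_l; auto. apply edvd_refl.
  - exfalso. apply Ha, edvd_trans with d; auto. apply edvd_antisym_enorm; auto.
    apply minimal. split; auto. apply edvd_trans with p; auto.
Qed.

Lemma eprime_unit_mul u p : enorm u = 1%Z -> eprime p -> eprime (u * p).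
Proof.
  intros Hu (p_neq_0 & p_nonunit & p_prime).
  assert (assoc : forall x, edvd (u * p) x <-> edvd p x).
  { intros x. split; intros D; (eapply edvd_trans; [|exact D]).
    - apply edvd_mul_l, edvd_refl.
    - apply (edvd_unit_mul u); auto. apply edvd_refl. }
  split; [|split].
  - intros H. apply emul_eq_0 in H as [-> | H]; [discriminate | auto].
  - rewrite enorm_mul, Hu, Z.mul_1_l. auto.
  - intros x y. rewrite !assoc. apply p_prime.
Qed.

Lemma enorm_prime_ge_2 p : eprime p -> (2 <= enorm p)%Z.
Proof. intros (p_neq_0 & p_nonunit & _). pose proof (enorm_pos p p_neq_0). lia. Qed.

Definition nonassociated_primes (P : list eisenstein) : Prop :=
  (forall p, In p P -> eprime p) /\ ForallOrdPairs (fun p q => ~ edvd q p) P.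

Lemma nonassociated_primes_cons p P : nonassociated_primes (p :: P) ->
  eprime p /\ (forall q, In q P -> ~ edvd q p) /\ nonassociated_primes P.
Proof.
  intros [HP H]. inversion H as [|? ? Hq HPP]; subst. rewrite Forall_forall in Hq.
  split; [apply HP; left; auto|]. split; auto. split; auto.
  intros q Hi. apply HP. right; auto.
Qed.

Lemma nonassociated_primes_NoDup P : nonassociated_primes P -> NoDup P.
Proof.
  induction P as [|p P IH]; [constructor|]. intros H.
  apply nonassociated_primes_cons in H as (_ & Hn & HP).
  constructor; auto. intros Hi. apply (Hn p Hi), edvd_refl.
Qed.

Lemma exists_nonassociated_prime_divisors (l : list eisenstein) :
  exists P, nonassociated_primes P /\
    forall x, In x l -> x <> 0%E -> enorm x <> 1%Z -> exists p, In p P /\ edvd p x.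
Proof.
  assert (exists Q, (forall q, In q Q -> eprime q) /\
    forall x, In x l -> x <> 0%E -> enorm x <> 1%Z -> exists p, In p Q /\ edvd p x)
    as (Q & HQ & CQ).
  { induction l as [|x l (Q & HQ & CQ)]; [exists nil; split; intros ? []|].
    destruct (classic (x <> 0%E /\ enorm x <> 1%Z)) as [[x_neq_0 x_nonunit]|Hx].
    - destruct (exists_prime_divisor x x_neq_0 x_nonunit) as (p & Pp & Dp).
      exists (p :: Q). split; [intros q [<-|Hq]; auto|].
      intros y [<-|Hy] y_neq_0 y_nonunit; [exists p; simpl; auto|].
      destruct (CQ y Hy y_neq_0 y_nonunit) as (q & Hq & Dq). exists q; simpl; auto.
    - exists Q. split; auto. intros y [<-|Hy]; [tauto | auto]. }
  destruct (maximal_independent_sublist edvd Q edvd_refl) as (P & Hi & HP & CP).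
  exists P. split.
  - split; auto.
  - intros x Hx x_neq_0 x_nonunit. destruct (CQ x Hx x_neq_0 x_nonunit) as (q & Hq & Dq).
    destruct (CP q Hq) as (p & Hp & Dp). exists p. split; auto. apply edvd_trans with q; auto.
Qed.

Lemma prime_power_enorm p n x : eprime p -> enorm x = (enorm p ^ Z.of_nat n)%Z ->
  exists u a b, enorm u = 1%Z /\ (a + b = n)%nat /\ x = (u * (p ^ a * econj p ^ b))%E.
Proof.
  intros Hp. revert x. induction n as [|n IH]; intros x Hx.
  - exists x, O, O. split; [exact Hx|]. split; auto. simpl. ring.
  - destruct Hp as (p_neq_0 & _ & p_prime). pose proof (enorm_pos p p_neq_0) as Np.
    rewrite Nat2Z.inj_succ, Z.pow_succ_r in Hx by lia.
    assert (edvd p (x * econj x)) as p_dvd.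
    { exists (econj p * ((enorm p ^ Z.of_nat n)%Z, 0%Z))%E. rewrite emul_conj, Hx.
      transitivity (p * econj p * ((enorm p ^ Z.of_nat n)%Z, 0%Z))%E; [|ring].
      rewrite emul_conj. unfold emul; cbn [fst snd]. f_equal; ring. }
    assert (exists z, (x = p * z)%E \/ (x = econj p * z)%E) as (z & Hz).
    { destruct (p_prime _ _ p_dvd) as [(z & Hz)|(z & Hz)]; [eauto|]. exists (econj z). right.
      rewrite <- econj_mul, <- Hz, econj_involutive. auto. }
    assert (enorm z = enorm p ^ Z.of_nat n)%Z as Nz.
    { destruct Hz as [-> | ->]; rewrite enorm_mul, ?enorm_conj in Hx;
        apply Z.mul_cancel_l in Hx; lia. }
    destruct (IH z Nz) as (u & a & b & Hu & Hab & ->).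
    destruct Hz as [-> | ->].
    + exists u, (S a), b. split; auto. split; [lia|]. simpl. ring.
    + exists u, a, (S b). split; auto. split; [lia|]. simpl. ring.
Qed.

Lemma coordinates_le_enorm x : x <> 0%E ->
  ((1 + Z.abs (fst x)) * (1 + Z.abs (snd x)) <= 6 * enorm x)%Z.
Proof.
  intros H. pose proof (enorm_pos x H) as P. destruct x as [a b].
  unfold enorm in *; cbn [fst snd] in *. clear H.
  assert (Z.abs a <= a * a)%Z by nia. assert (Z.abs b <= b * b)%Z by nia.
  assert (Z.abs a * Z.abs b <= a * a + a * b + b * b)%Z.
  { rewrite <- Z.abs_mul. pose proof (Z.square_nonneg (a - b)).
    pose proof (Z.square_nonneg (a + b)). lia. }
  pose proof (Z.square_nonneg (a + b)).
  generalize dependent (Z.abs a); generalize dependent (Z.abs b); intros; lia.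
Qed.

Definition zbox (n : nat) : list Z :=
  map Z.of_nat (seq 0 n) ++ map (fun i => (- Z.of_nat i)%Z) (seq 0 n).

Lemma zbox_In n a : (Z.abs a < Z.of_nat n)%Z -> In a (zbox n).
Proof.
  intros H. apply in_or_app. destruct (Z_le_dec 0 a).
  - left. apply in_map_iff. exists (Z.to_nat a). rewrite in_seq. lia.
  - right. apply in_map_iff. exists (Z.to_nat (- a)). rewrite in_seq. lia.
Qed.

Lemma enorm_lt_finite (n : Z) :
  exists l : list eisenstein, forall x, (enorm x < n)%Z -> In x l.
Proof.
  set (m := Z.to_nat (6 * n + 1)). exists (list_prod (zbox m) (zbox m)). intros [a b] H.
  pose proof (enorm_nonneg (a, b)).
  apply in_prod; apply zbox_In.
  all: destruct (classic ((a, b) = 0%E)) as [E|neq_0];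
    [injection E as -> ->; simpl; lia |].
  all: apply coordinates_le_enorm in neq_0; cbn [fst snd] in neq_0; nia.
Qed.

Definition residue_system (b : eisenstein) (J : list eisenstein) : Prop :=
  (forall y, exists j x, In j J /\ y = (b * x + j)%E) /\
  NoDup J /\
  forall i j x y, In i J -> In j J -> (b * x + i = b * y + j)%E -> i = j.

Lemma exists_residue_system b : b <> 0%E -> exists J, residue_system b J.
Proof.
  intros Hb. destruct (enorm_lt_finite (enorm b)) as (l & Hl).
  destruct (maximal_independent_sublist (fun j x => edvd b (x - j)) l) as (J & _ & HJ & CJ).
  { intros x. exists 0%E. ring. }
  assert (distinct : forall i j x y, In i J -> In j J -> (b * x + i = b * y + j)%E -> i = j).
  { intros i j x y Hi Hj E. destruct (ForallOrdPairs_In HJ i j Hi Hj) as [|[H|H]]; auto;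
      exfalso; apply H.
    - exists (y - x)%E. replace i with (b * x + i - b * x)%E at 1 by ring. rewrite E. ring.
    - exists (x - y)%E. replace j with (b * y + j - b * y)%E at 1 by ring. rewrite <- E. ring. }
  exists J. split; [|split; auto].
  - intros y. destruct (euclidean_division y b Hb) as (q & Hq).
    destruct (CJ _ (Hl _ Hq)) as (j & Hj & (z & Hz)). exists j, (q + z)%E. split; auto.
    replace y with (y - b * q - j + (b * q + j))%E by ring. rewrite Hz. ring.
  - clear - HJ. induction HJ as [|x J Hx HJ IH]; constructor; auto.
    rewrite Forall_forall in Hx. intros Hi. apply (Hx x Hi). exists 0%E. ring.
Qed.

(** * Polar coordinates and real powers *)

Lemma cis_0 : cis 0 = RtoC 1.
Proof. unfold cis. rewrite cos_0, sin_0. reflexivity. Qed.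

Lemma cis_plus a b : cis (a + b) = (cis a * cis b)%C.
Proof. unfold cis, Cmult; simpl. rewrite cos_plus, sin_plus. f_equal; ring. Qed.

Lemma cis_pow t n : (cis t ^ n)%C = cis (INR n * t).
Proof.
  induction n as [|n IH].
  - rewrite Rmult_0_l, cis_0. reflexivity.
  - rewrite Cpow_S, IH, <- cis_plus, S_INR. f_equal. ring.
Qed.

Lemma cis_conj t : Cconj (cis t) = cis (- t).
Proof. unfold cis, Cconj; simpl. rewrite cos_neg, sin_neg. reflexivity. Qed.

Lemma Cmod_cis t : Cmod (cis t) = 1.
Proof.
  apply Rsqr_inj; [apply Cmod_ge_0 | lra|]. rewrite !Rsqr_pow2, Cmod2_alt. simpl.
  pose proof (sin2_cos2 t) as H. unfold Rsqr in H. lra.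
Qed.

Lemma cis_period t (q : Z) : cis (t + 2 * IZR q * PI) = cis t.
Proof.
  assert (forall u n, cis (u + 2 * INR n * PI) = cis u) as nonneg.
  { intros u n. unfold cis. rewrite cos_period, sin_period. reflexivity. }
  destruct (Z_le_dec 0 q) as [H|H].
  - rewrite <- (Z2Nat.id q), <- INR_IZR_INZ by auto. apply nonneg.
  - rewrite <- (nonneg (t + 2 * IZR q * PI) (Z.to_nat (- q))).
    rewrite INR_IZR_INZ, Z2Nat.id, opp_IZR by lia. f_equal; ring.
Qed.

Lemma unit_circle_cis (z : C) : Cmod z = 1 -> exists t, z = cis t.
Proof.
  intros Hz. pose proof (Cmod2_alt z) as sqr. rewrite Hz in sqr.
  destruct z as [x y]. simpl in sqr.
  assert (-1 <= x <= 1) as bound by nra.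
  assert (sin (acos x) = Rabs y) as sin_acos_x.
  { rewrite sin_acos, <- sqrt_Rsqr_abs by auto. f_equal. unfold Rsqr. lra. }
  destruct (Rle_dec 0 y) as [sign_y|sign_y].
  - exists (acos x). unfold cis. rewrite cos_acos, sin_acos_x, Rabs_pos_eq; auto.
  - exists (- acos x). unfold cis. rewrite cos_neg, sin_neg, cos_acos, sin_acos_x, Rabs_left by lra.
    f_equal. ring.
Qed.

(* At [z = 0] this is [0], since [Cmod] vanishes there and [0 * / 0 = 0]. *)
Definition dir (z : C) : C := (z * RtoC (/ Cmod z))%C.

Lemma dir_mul (z w : C) : dir (z * w) = (dir z * dir w)%C.
Proof. unfold dir. rewrite Cmod_mult, Rinv_mult, RtoC_mult. ring. Qed.

Lemma Cmod_dir (z : C) : z <> 0 -> Cmod (dir z) = 1.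
Proof.
  intros H. pose proof (proj1 (Cmod_gt_0 z) H) as P.
  unfold dir. rewrite Cmod_mult, Cmod_R, Rabs_pos_eq.
  - apply Rinv_r. lra.
  - left. apply Rinv_0_lt_compat; auto.
Qed.

Lemma Cmod_mult_dir (z : C) : z <> 0 -> (RtoC (Cmod z) * dir z)%C = z.
Proof.
  intros H. pose proof (proj1 (Cmod_gt_0 z) H) as P. unfold dir.
  transitivity (RtoC (Cmod z * / Cmod z) * z)%C; [rewrite RtoC_mult; ring|].
  rewrite Rinv_r by lra. ring.
Qed.

Lemma Cmod_minus_ge (z w : C) : Rabs (Cmod z - Cmod w) <= Cmod (z - w).
Proof. exact (norm_triangle_inv (V := C_NormedModule) z w). Qed.

Lemma dir_lipschitz (z w : C) : z <> 0 -> w <> 0 ->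
  Cmod (dir w - dir z) <= 2 * Cmod (w - z) / Cmod z.
Proof.
  intros Hz Hw. pose proof (proj1 (Cmod_gt_0 z) Hz) as Pz.
  apply (Rmult_le_reg_l (Cmod z)); auto.
  replace (Cmod z * (2 * Cmod (w - z) / Cmod z)) with (Cmod (w - z) + Cmod (w - z))
    by (field; lra).
  rewrite <- (Rabs_pos_eq (Cmod z)) at 1 by lra. rewrite <- Cmod_R, <- Cmod_mult.
  replace (RtoC (Cmod z) * (dir w - dir z))%C
    with ((w - z) + - (RtoC (Cmod w - Cmod z) * dir w))%C.
  - eapply Rle_trans; [apply Cmod_triangle|]. apply Rplus_le_compat_l.
    rewrite Cmod_opp, Cmod_mult, Cmod_R, Cmod_dir, Rmult_1_r by auto. apply Cmod_minus_ge.
  - rewrite <- (Cmod_mult_dir w Hw) at 1. rewrite <- (Cmod_mult_dir z Hz) at 1.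
    rewrite RtoC_minus. ring.
Qed.

Lemma Cpow_lipschitz (a b : C) n :
  Cmod a <= 1 -> Cmod b <= 1 -> Cmod (a ^ n - b ^ n) <= INR n * Cmod (a - b).
Proof.
  intros Ha Hb. induction n as [|n IH].
  - simpl. replace (1 - 1)%C with (RtoC 0) by ring. rewrite Cmod_0; lra.
  - rewrite S_INR, !Cpow_S.
    replace (a * a ^ n - b * b ^ n)%C with (a * (a ^ n - b ^ n) + b ^ n * (a - b))%C by ring.
    eapply Rle_trans; [apply Cmod_triangle|]. rewrite !Cmod_mult, Cmod_pow.
    assert (Cmod b ^ n <= 1).
    { rewrite <- (pow1 n). apply pow_incr; split; [apply Cmod_ge_0 | auto]. }
    pose proof (Cmod_ge_0 (a ^ n - b ^ n)). pose proof (Cmod_ge_0 (a - b)).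
    pose proof (Cmod_ge_0 a). nra.
Qed.

Lemma exp_le_compat x y : x <= y -> exp x <= exp y.
Proof. intros [H| ->]; [left; apply exp_increasing; auto | apply Rle_refl]. Qed.

Lemma Rpower_pos x y : 0 < Rpower x y.
Proof. apply exp_pos. Qed.

Lemma Rpower_1_l y : Rpower 1 y = 1.
Proof. unfold Rpower. rewrite ln_1, Rmult_0_r. apply exp_0. Qed.

Lemma Rpower_opp_antitone x y c : 0 <= c -> 0 < x <= y -> Rpower y (- c) <= Rpower x (- c).
Proof.
  intros Hc Hx. rewrite !Rpower_Ropp. apply Rinv_le_contravar; [apply Rpower_pos|].
  apply Rle_Rpower_l; auto.
Qed.

Lemma Rpower_opp_lipschitz t a b : 0 <= t -> 0 < a -> 2 * Rabs (b - a) <= a ->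
  Rabs (Rpower b (- t) - Rpower a (- t)) <=
    t * Rpower 2 (t + 1) * Rpower a (- (t + 1)) * Rabs (b - a).
Proof.
  intros Ht Ha Hab.
  apply (bounded_variation (fun x => Rpower x (- t)) (fun x => - t * Rpower x (- t - 1))).
  intros x Hx. assert (a / 2 <= x <= 3 * a / 2) as near.
  { apply Rabs_le_between in Hx. lra. }
  split; [apply is_derive_Reals, derivable_pt_lim_power; lra|].
  replace (- t - 1) with (- (t + 1)) by ring.
  rewrite Rabs_mult, Rabs_Ropp, !Rabs_pos_eq, Rmult_assoc by (auto; left; apply Rpower_pos).
  apply Rmult_le_compat_l; auto.
  replace (Rpower 2 (t + 1) * Rpower a (- (t + 1))) with (Rpower (a / 2) (- (t + 1))).
  - apply Rpower_opp_antitone; lra.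
  - unfold Rpower. rewrite <- exp_plus, ln_div by lra. f_equal. ring.
Qed.

Lemma Rpower_telescope s x : 1 < s -> 0 < x ->
  (s - 1) * Rpower (x + 1) (- s) <= Rpower x (1 - s) - Rpower (x + 1) (1 - s).
Proof.
  intros Hs Hx.
  destruct (MVT_cor2 (fun y => Rpower y (1 - s)) (fun y => (1 - s) * Rpower y (1 - s - 1))
    x (x + 1)) as (c & Hc & Hxc); [lra | |].
  { intros c Hc. apply derivable_pt_lim_power. lra. }
  replace (1 - s - 1) with (- s) in Hc by ring.
  pose proof (Rpower_opp_antitone c (x + 1) s ltac:(lra) ltac:(lra)). nra.
Qed.

Lemma lsum_Rpower_opp_le s n : 1 < s ->
  lsum (fun i => Rpower (1 + INR i) (- s)) (seq 0 n) <= s / (s - 1).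
Proof.
  intros Hs.
  assert (partial : forall n, (s - 1) * lsum (fun i => Rpower (1 + INR i) (- s)) (seq 0 (S n)) <=
    s - Rpower (1 + INR n) (1 - s)).
  { clear n. induction n as [|n IH].
    - simpl seq. rewrite lsum_Rcons. change (lsum _ nil) with 0. simpl INR.
      rewrite !Rplus_0_r, !Rpower_1_l. lra.
    - rewrite seq_S, lsum_Rapp, Rmult_plus_distr_l.
      simpl (0 + S n)%nat. rewrite lsum_Rcons. change (lsum _ nil) with 0.
      pose proof (pos_INR n).
      pose proof (Rpower_telescope s (1 + INR n) Hs ltac:(lra)) as T.
      rewrite S_INR. rewrite Rplus_assoc in T. lra. }
  apply (Rmult_le_reg_l (s - 1)); [lra|].
  replace ((s - 1) * (s / (s - 1))) with s by (field; lra).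
  destruct n as [|n]; [change (lsum _ _) with 0; lra|].
  pose proof (partial n). pose proof (Rpower_pos (1 + INR n) (1 - s)). lra.
Qed.

Definition hecke_kernel (n : nat) (t : R) (z : C) : C :=
  (dir z ^ n * RtoC (Rpower (Cmod z) (- t)))%C.

Lemma hecke_kernel_lipschitz n t (z w : C) : 0 <= t -> z <> 0 -> 2 * Cmod (w - z) <= Cmod z ->
  Cmod (hecke_kernel n t w - hecke_kernel n t z) <=
    (2 * INR n + t * Rpower 2 (t + 1)) * Rpower (Cmod z) (- (t + 1)) * Cmod (w - z).
Proof.
  intros Ht Hz Hd. pose proof (proj1 (Cmod_gt_0 z) Hz) as Pz.
  pose proof (Cmod_minus_ge w z) as reverse_triangle.
  assert (w <> 0) as Hw.
  { apply Cmod_gt_0. apply Rabs_le_between in reverse_triangle. lra. }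
  set (d := Cmod (w - z)) in *.
  assert (angular : Cmod (dir w ^ n - dir z ^ n) <= 2 * INR n * d / Cmod z).
  { eapply Rle_trans; [apply Cpow_lipschitz; rewrite Cmod_dir; auto; lra|].
    replace (2 * INR n * d / Cmod z) with (INR n * (2 * d / Cmod z)) by (field; lra).
    apply Rmult_le_compat_l; [apply pos_INR | apply dir_lipschitz; auto]. }
  assert (radial : Rabs (Rpower (Cmod w) (- t) - Rpower (Cmod z) (- t)) <=
    t * Rpower 2 (t + 1) * Rpower (Cmod z) (- (t + 1)) * d).
  { eapply Rle_trans; [apply Rpower_opp_lipschitz; auto; lra|].
    apply Rmult_le_compat_l; auto. repeat apply Rmult_le_pos; auto; left; apply Rpower_pos. }
  replace (hecke_kernel n t w - hecke_kernel n t z)%C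
    with (dir w ^ n * RtoC (Rpower (Cmod w) (- t) - Rpower (Cmod z) (- t)) +
      (dir w ^ n - dir z ^ n) * RtoC (Rpower (Cmod z) (- t)))%C
    by (unfold hecke_kernel; rewrite RtoC_minus; ring).
  eapply Rle_trans; [apply Cmod_triangle|].
  rewrite !Cmod_mult, !Cmod_R, Cmod_pow, Cmod_dir, pow1, Rmult_1_l by auto.
  rewrite (Rabs_pos_eq (Rpower _ _)) by (left; apply Rpower_pos).
  pose proof (Rpower_pos (Cmod z) (- t)) as radial_pos.
  apply (Rmult_le_compat_r (Rpower (Cmod z) (- t))) in angular; [|lra].
  assert (Rpower (Cmod z) (- (t + 1)) = Rpower (Cmod z) (- t) * / Cmod z) as split_power.
  { replace (- (t + 1)) with (- t + - (1)) by ring.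
    rewrite Rpower_plus, (Rpower_Ropp _ 1), Rpower_1; auto. }
  rewrite split_power in *.
  replace (2 * INR n * d / Cmod z * Rpower (Cmod z) (- t))
    with (2 * INR n * (Rpower (Cmod z) (- t) * / Cmod z) * d) in angular by (field; lra).
  lra.
Qed.

(** * Hecke characters and their L-series *)

Definition toC (x : eisenstein) : C := (RtoC (IZR (fst x)) + RtoC (IZR (snd x)) * omega)%C.

(* The exponent is a multiple of 6 so that [chi m] is trivial on units. *)
Definition chi (m : nat) (x : eisenstein) : C := (dir (toC x) ^ (6 * m))%C.

(* [N(x) ^ (- s)], extended by [0] at [0] so that it is multiplicative. *)
Definition nweight (s : R) (x : eisenstein) : R :=
  if Z.eq_dec (enorm x) 0 then 0 else Rpower (IZR (enorm x)) (- s).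

Definition hecke (m : nat) (s : R) (x : eisenstein) : C := (chi m x * RtoC (nweight s x))%C.

Lemma toC_pair x : toC x = (IZR (fst x) + IZR (snd x) / 2, IZR (snd x) * (sqrt 3 / 2)).
Proof.
  unfold toC, omega. rewrite cos_PI3, sin_PI3. unfold Cplus, Cmult, RtoC; simpl. f_equal; field.
Qed.

Lemma toC_0 : toC 0%E = RtoC 0.
Proof. unfold toC. simpl. ring. Qed.

Lemma toC_1 : toC 1%E = RtoC 1.
Proof. unfold toC. simpl. ring. Qed.

Lemma toC_omega : toC eomega = cis (PI / 3).
Proof. unfold toC. simpl. fold omega. change (cis (PI / 3)) with omega. ring. Qed.

Lemma toC_mul x y : toC (x * y) = (toC x * toC y)%C.
Proof.
  rewrite !toC_pair. destruct x as [a b], y as [c d]. unfold emul, Cmult; cbn [fst snd].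
  repeat rewrite ?plus_IZR, ?minus_IZR, ?mult_IZR.
  pose proof (sqrt_sqrt 3 ltac:(lra)) as S. f_equal; [|field].
  replace ((IZR a + IZR b / 2) * (IZR c + IZR d / 2) -
    IZR b * (sqrt 3 / 2) * (IZR d * (sqrt 3 / 2)))
    with ((IZR a + IZR b / 2) * (IZR c + IZR d / 2) -
      IZR b * IZR d / 4 * (sqrt 3 * sqrt 3)) by field.
  rewrite S. field.
Qed.

Lemma toC_add x y : toC (x + y) = (toC x + toC y)%C.
Proof. unfold toC. cbn [fst snd eadd]. rewrite !plus_IZR, !RtoC_plus. ring. Qed.

Lemma toC_pow x n : toC (x ^ n) = (toC x ^ n)%C.
Proof. induction n as [|n IH]; simpl; [apply toC_1 | rewrite toC_mul, IH; reflexivity]. Qed.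

Lemma toC_conj x : toC (econj x) = Cconj (toC x).
Proof.
  rewrite !toC_pair. destruct x as [a b]. unfold econj, Cconj; cbn [fst snd].
  rewrite plus_IZR, opp_IZR. f_equal; field.
Qed.

Lemma Cmod_toC_sqr x : Cmod (toC x) ^ 2 = IZR (enorm x).
Proof.
  rewrite Cmod2_alt, toC_pair. destruct x as [a b]. unfold enorm, Re, Im; cbn [fst snd].
  repeat rewrite ?plus_IZR, ?mult_IZR.
  replace ((IZR b * (sqrt 3 / 2)) ^ 2) with (IZR b * IZR b / 4 * (sqrt 3 * sqrt 3)) by field.
  rewrite sqrt_sqrt by lra. field.
Qed.

Lemma enorm_ge_1 x : x <> 0%E -> 1 <= IZR (enorm x).
Proof. intros H. apply (IZR_le 1). pose proof (enorm_pos x H). lia. Qed.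

Lemma Cmod_toC_ge_1 x : x <> 0%E -> 1 <= Cmod (toC x).
Proof.
  intros H. pose proof (Cmod_ge_0 (toC x)). pose proof (Cmod_toC_sqr x) as S.
  pose proof (enorm_ge_1 x H). nra.
Qed.

Lemma toC_neq_0 x : x <> 0%E -> toC x <> 0.
Proof. intros H. apply Cmod_gt_0. pose proof (Cmod_toC_ge_1 x H). lra. Qed.

Lemma chi_mul m x y : chi m (x * y) = (chi m x * chi m y)%C.
Proof. unfold chi. rewrite toC_mul, dir_mul. apply Cpow_mult_l. Qed.

Lemma Cmod_chi m x : x <> 0%E -> Cmod (chi m x) = 1.
Proof.
  intros H. unfold chi. rewrite Cmod_pow, Cmod_dir by (apply toC_neq_0; auto). apply pow1.
Qed.

Lemma chi_polar m x t : dir (toC x) = cis t -> chi m x = cis (INR m * (6 * t)).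
Proof.
  intros Hx. unfold chi. rewrite Hx, cis_pow, mult_INR. f_equal. simpl; ring.
Qed.

Lemma chi_unit m u : enorm u = 1%Z -> chi m u = RtoC 1.
Proof.
  intros H. assert (Cmod (toC u) = 1) as Hc.
  { pose proof (Cmod_toC_sqr u) as S. pose proof (Cmod_ge_0 (toC u)). rewrite H in S. nra. }
  unfold chi, dir. rewrite Hc, Rinv_1, Cmult_1_r, Cpow_mult_r, <- toC_pow, unit_pow_6 by auto.
  rewrite toC_1. apply Cpow_1_l.
Qed.

Lemma nweight_0 s : nweight s 0%E = 0.
Proof. reflexivity. Qed.

Lemma nweight_neq_0 s x : x <> 0%E -> nweight s x = Rpower (IZR (enorm x)) (- s).
Proof.
  intros H. unfold nweight. destruct (Z.eq_dec (enorm x) 0) as [norm_0|]; auto.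
  apply enorm_eq_0 in norm_0. tauto.
Qed.

Lemma nweight_nonneg s x : 0 <= nweight s x.
Proof. unfold nweight. destruct Z.eq_dec; [lra|]. left. apply Rpower_pos. Qed.

Lemma nweight_mul s x y : nweight s (x * y) = nweight s x * nweight s y.
Proof.
  destruct (classic (x = 0%E)) as [->|Hx].
  { replace (0 * y)%E with 0%E by ring. rewrite nweight_0. ring. }
  destruct (classic (y = 0%E)) as [->|Hy].
  { replace (x * 0)%E with 0%E by ring. rewrite nweight_0. ring. }
  rewrite !nweight_neq_0; auto.
  - rewrite enorm_mul, mult_IZR, Rpower_mult_distr; auto; apply (IZR_lt 0), enorm_pos; auto.
  - intros H. apply emul_eq_0 in H. tauto.
Qed.

Lemma nweight_unit s u : enorm u = 1%Z -> nweight s u = 1.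
Proof.
  intros H. rewrite nweight_neq_0 by (intros ->; discriminate). rewrite H. apply Rpower_1_l.
Qed.

Lemma nweight_antitone s t x : s <= t -> nweight t x <= nweight s x.
Proof.
  intros H. destruct (classic (x = 0%E)) as [->|Hx]; [rewrite !nweight_0; lra|].
  rewrite !nweight_neq_0 by auto. apply Rle_Rpower; [apply enorm_ge_1; auto | lra].
Qed.

Lemma nweight_le_1 s x : 0 <= s -> nweight s x <= 1.
Proof.
  intros H. eapply Rle_trans; [apply (nweight_antitone 0); auto|].
  unfold nweight. destruct Z.eq_dec as [|Hn]; [lra|]. rewrite Ropp_0, Rpower_O; [lra|].
  apply (IZR_lt 0). pose proof (enorm_nonneg x). lia.
Qed.

Lemma nweight_Cmod s x : x <> 0%E -> nweight s x = Rpower (Cmod (toC x)) (- (2 * s)).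
Proof.
  intros H. pose proof (Cmod_toC_ge_1 x H).
  rewrite nweight_neq_0, <- Cmod_toC_sqr, <- Rpower_pow, Rpower_mult by (auto; lra).
  f_equal. simpl. ring.
Qed.

Lemma hecke_kernel_toC m s x : x <> 0%E -> hecke m s x = hecke_kernel (6 * m) (2 * s) (toC x).
Proof. intros H. unfold hecke, hecke_kernel. rewrite nweight_Cmod; auto. Qed.

Lemma hecke_mul m s x y : hecke m s (x * y) = (hecke m s x * hecke m s y)%C.
Proof. unfold hecke. rewrite chi_mul, nweight_mul, RtoC_mult. ring. Qed.

Lemma hecke_0 m s : hecke m s 0%E = RtoC 0.
Proof. unfold hecke. rewrite nweight_0. ring. Qed.

Lemma hecke_unit m s u : enorm u = 1%Z -> hecke m s u = RtoC 1.
Proof. intros H. unfold hecke. rewrite chi_unit, nweight_unit by auto. ring. Qed.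

Lemma Cmod_hecke m s x : Cmod (hecke m s x) = nweight s x.
Proof.
  unfold hecke. rewrite Cmod_mult, Cmod_R, Rabs_pos_eq by apply nweight_nonneg.
  destruct (classic (x = 0%E)) as [->|Hx]; [rewrite nweight_0; ring|].
  rewrite Cmod_chi; auto; ring.
Qed.

Lemma Re_hecke m s x : Re (hecke m s x) = Re (chi m x) * nweight s x.
Proof. unfold hecke. destruct (chi m x) as [u v]. simpl. ring. Qed.

Lemma hecke_trivial s x : hecke 0 s x = RtoC (nweight s x).
Proof. unfold hecke, chi. simpl. ring. Qed.

Definition coord_weight (s : R) (a : Z) : R := Rpower (1 + IZR (Z.abs a)) (- s).

Definition box_weight (s : R) (x : eisenstein) : R :=
  coord_weight s (fst x) * coord_weight s (snd x).

Lemma lsum_coord_weight_le s n : 1 < s -> lsum (coord_weight s) (zbox n) <= 2 * (s / (s - 1)).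
Proof.
  intros Hs. unfold zbox. rewrite lsum_Rapp, !lsum_map.
  pose proof (lsum_Rpower_opp_le s n Hs) as Hn.
  apply Rle_trans with (s / (s - 1) + s / (s - 1)); [|lra].
  apply Rplus_le_compat; (eapply Rle_trans; [right; apply lsum_ext | apply Hn]);
    intros i _; unfold coord_weight; rewrite ?Z.abs_opp, Z.abs_eq, INR_IZR_INZ; auto; lia.
Qed.

Lemma incl_zbox_square (l : list eisenstein) : exists n, incl l (list_prod (zbox n) (zbox n)).
Proof.
  assert (exists n, forall x, In x l ->
    (Z.abs (fst x) + Z.abs (snd x) < Z.of_nat n)%Z) as (n & Hn).
  { induction l as [|x l (n & Hn)]; [exists O; intros x []|].
    exists (S (n + Z.to_nat (Z.abs (fst x) + Z.abs (snd x)))).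
    intros y [<-|Hy]; [lia | specialize (Hn y Hy); lia]. }
  exists n. intros [a b] Hx. specialize (Hn _ Hx). cbn [fst snd] in Hn.
  apply in_prod; apply zbox_In; lia.
Qed.

Lemma box_weight_nonneg s x : 0 <= box_weight s x.
Proof. apply Rmult_le_pos; left; apply Rpower_pos. Qed.

Lemma box_weight_0 s : box_weight s 0%E = 1.
Proof. unfold box_weight, coord_weight; simpl. rewrite Rplus_0_r, Rpower_1_l. ring. Qed.

Lemma box_weight_summable s : 1 < s -> summable (box_weight s).
Proof.
  intros Hs. split; [apply box_weight_nonneg|].
  exists ((2 * (s / (s - 1))) * (2 * (s / (s - 1)))). intros l Nl.
  destruct (incl_zbox_square l) as (n & Hn).
  eapply Rle_trans; [apply (lsum_incl _ _ _ (box_weight_nonneg s) Nl Hn)|].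
  unfold box_weight. rewrite (lsum_list_prod (coord_weight s) (coord_weight s)).
  pose proof (lsum_coord_weight_le s n Hs).
  assert (0 <= lsum (coord_weight s) (zbox n)).
  { apply lsum_nonneg. intros. left. apply Rpower_pos. }
  apply Rmult_le_compat; auto.
Qed.

Lemma nweight_le_box s x : 0 <= s -> nweight s x <= Rpower 6 s * box_weight s x.
Proof.
  intros Hs. destruct (classic (x = 0%E)) as [->|Hx].
  { rewrite nweight_0. apply Rmult_le_pos; [left; apply Rpower_pos | apply box_weight_nonneg]. }
  assert (P : forall a, 0 < 1 + IZR (Z.abs a)).
  { intros a. pose proof (IZR_le _ _ (Z.abs_nonneg a)). lra. }
  unfold box_weight, coord_weight. rewrite Rpower_mult_distr by auto.
  rewrite <- !plus_IZR, <- mult_IZR. pose proof (IZR_le _ _ (coordinates_le_enorm x Hx)) as L.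
  rewrite (mult_IZR 6) in L. pose proof (enorm_ge_1 x Hx) as norm_ge_1.
  set (q := IZR ((1 + Z.abs (fst x)) * (1 + Z.abs (snd x)))) in *.
  assert (0 < q).
  { unfold q. rewrite mult_IZR, !plus_IZR. apply Rmult_lt_0_compat; apply P. }
  rewrite nweight_neq_0 by auto.
  replace (Rpower (IZR (enorm x)) (- s))
    with (Rpower 6 s * Rpower (6 * IZR (enorm x)) (- s)).
  - apply Rmult_le_compat_l; [left; apply Rpower_pos|]. apply Rpower_opp_antitone; lra.
  - rewrite <- Rpower_mult_distr by lra. rewrite <- Rmult_assoc, <- Rpower_plus, Rplus_opp_r.
    rewrite Rpower_O by lra. ring.
Qed.

Lemma nweight_summable s : 1 < s -> summable (nweight s).
Proof.
  intros Hs. apply (summable_le _ (fun x => Rpower 6 s * box_weight s x)).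
  - intros x. split; [apply nweight_nonneg | apply nweight_le_box; lra].
  - apply summable_scal; [left; apply Rpower_pos | apply box_weight_summable; auto].
Qed.

Lemma hecke_has_sum m s : 1 < s -> exists L, has_sum (hecke m s) L.
Proof.
  intros Hs. apply (summable_has_sum (V := C_CompleteNormedModule) _ (nweight s));
    [|apply nweight_summable; auto].
  intros x. right. apply Cmod_hecke.
Qed.

(** * Boundedness of the L-series near 1 *)

Lemma hecke_translate_far m s x y : 1 <= s <= 2 -> x <> 0%E ->
  2 * Cmod (toC y) <= Cmod (toC x) ->
  Cmod (hecke m s (x + y) - hecke m s x) <=
    (12 * INR m + 128) * Cmod (toC y) * nweight (3 / 2) x.
Proof.
  intros Hs Hx Hy. pose proof (Cmod_toC_ge_1 x Hx) as x_ge_1.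
  assert (toC (x + y) - toC x = toC y)%C as Ed by (rewrite toC_add; ring).
  assert (x + y <> 0)%E as Hxy.
  { intros E. rewrite E, toC_0 in Ed. rewrite <- Ed in Hy.
    replace (0 - toC x)%C with (- toC x)%C in Hy by ring. rewrite Cmod_opp in Hy. lra. }
  rewrite !hecke_kernel_toC by auto.
  eapply Rle_trans.
  { apply hecke_kernel_lipschitz; [lra | apply toC_neq_0; auto | rewrite Ed; auto]. }
  rewrite Ed, nweight_Cmod by auto.
  rewrite (Rmult_assoc _ (Cmod (toC y))), (Rmult_comm (Cmod (toC y))).
  rewrite <- Rmult_assoc. apply Rmult_le_compat_r; [apply Cmod_ge_0|].
  apply Rmult_le_compat; [|left; apply Rpower_pos| |apply Rle_Rpower; lra].
  - pose proof (pos_INR (6 * m)). pose proof (Rpower_pos 2 (2 * s + 1)).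
    apply Rplus_le_le_0_compat; [lra | apply Rmult_le_pos; lra].
  - rewrite mult_INR. replace (INR 6) with 6 by (simpl; ring).
    assert (Rpower 2 (2 * s + 1) <= 32).
    { replace 32 with (Rpower 2 5); [apply Rle_Rpower; lra|].
      replace 5 with (INR 5) by (simpl; ring). rewrite Rpower_pow by lra. ring. }
    pose proof (Rpower_pos 2 (2 * s + 1)). nra.
Qed.

Lemma hecke_residue_error m b j : b <> 0%E -> exists K, forall s x, 1 <= s <= 2 ->
  Cmod (hecke m s (b * x + j) - hecke m s (b * x)) <= K * box_weight (3 / 2) x.
Proof.
  intros Hb. set (d := Cmod (toC j)). pose proof (Cmod_ge_0 (toC j) : 0 <= d) as d_nonneg.
  pose proof (pos_INR m) as m_nonneg.
  set (A := (12 * INR m + 128) * d). set (B := 2 * (2 * d) ^ 3).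
  assert (0 <= A) as A_nonneg by (apply Rmult_le_pos; lra).
  assert (0 <= B) as B_nonneg by (apply Rmult_le_pos; [lra | apply pow_le; lra]).
  exists (2 + (A + B) * Rpower 6 (3 / 2)). intros s x Hs.
  assert (Cmod (hecke m s (b * x + j) - hecke m s (b * x)) <= 2) as trivial_bound.
  { unfold Cminus. eapply Rle_trans; [apply Cmod_triangle|]. rewrite Cmod_opp, !Cmod_hecke.
    pose proof (nweight_le_1 s (b * x + j)). pose proof (nweight_le_1 s (b * x)). lra. }
  pose proof (Rpower_pos 6 (3 / 2)) as six_pos.
  pose proof (box_weight_nonneg (3 / 2) x) as box_nonneg.
  destruct (classic (x = 0%E)) as [->|Hx].
  { rewrite box_weight_0, Rmult_1_r. nra. }
  assert (b * x <> 0)%E as Hbx by (intros H; apply emul_eq_0 in H; tauto).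
  apply Rle_trans with ((A + B) * nweight (3 / 2) x).
  2:{ pose proof (nweight_le_box (3 / 2) x ltac:(lra)). nra. }
  pose proof (nweight_nonneg (3 / 2) x) as weight_nonneg.
  destruct (Rle_dec (2 * d) (Cmod (toC (b * x)))) as [Far|Near].
  - eapply Rle_trans; [apply hecke_translate_far; auto|]. fold d A.
    rewrite nweight_mul. rewrite <- Rmult_assoc. apply Rmult_le_compat_r; auto.
    pose proof (nweight_le_1 (3 / 2) b ltac:(lra)). nra.
  - eapply Rle_trans; [apply trivial_bound|].
    assert (1 <= (2 * d) ^ 3 * nweight (3 / 2) x); [|unfold B in *; nra].
    pose proof (Cmod_toC_ge_1 x Hx) as x_ge_1.
    assert (Cmod (toC x) <= 2 * d) as Xd.
    { rewrite toC_mul, Cmod_mult in Near. pose proof (Cmod_toC_ge_1 b Hb). nra. }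
    rewrite nweight_Cmod by auto. replace (2 * (3 / 2)) with (INR 3) by (simpl; field).
    rewrite Rpower_Ropp, Rpower_pow by lra.
    apply (Rmult_le_reg_r (Cmod (toC x) ^ 3)); [apply pow_lt; lra|].
    rewrite Rmult_assoc, Rinv_l by (apply pow_nonzero; lra).
    rewrite Rmult_1_l, Rmult_1_r. apply pow_incr. lra.
Qed.

Lemma hecke_residue_class_sum m b j : b <> 0%E ->
  exists K, forall s L, 1 < s <= 2 -> has_sum (hecke m s) L ->
    exists M, has_sum (fun x => hecke m s (b * x + j)) M /\
      Cmod (M - hecke m s b * L) <= K.
Proof.
  intros Hb. destruct (hecke_residue_error m b j Hb) as (K & HK).
  destruct (box_weight_summable (3 / 2)) as (_ & W & HW); [lra|].
  assert (0 <= K) as K_nonneg.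
  { specialize (HK 1 0%E ltac:(lra)). rewrite box_weight_0, Rmult_1_r in HK.
    eapply Rle_trans; [apply Cmod_ge_0 | apply HK]. }
  exists (K * W). intros s L Hs HL.
  destruct (summable_has_sum (V := C_CompleteNormedModule) (fun x => hecke m s (b * x + j))
    (fun x => nweight s (b * x + j))) as (M & HM).
  { intros x. right. apply Cmod_hecke. }
  { apply (summable_comp (fun x => b * x + j)%E);
      [apply affine_injective; auto | apply nweight_summable; lra]. }
  exists M. split; auto.
  apply (has_sum_norm_le (V := C_NormedModule) _ (fun x => K * box_weight (3 / 2) x) _ _
    (has_sum_minus _ _ _ _ HM (has_sum_scal (hecke m s b) _ _ HL))).
  - intros x. change (Cmod (hecke m s (b * x + j) - hecke m s b * hecke m s x) <=
      K * box_weight (3 / 2) x).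
    rewrite <- hecke_mul. apply HK. lra.
  - intros l Nl. rewrite lsum_Rmult_l. apply Rmult_le_compat_l; auto.
Qed.

Definition residue_class (b j y : eisenstein) : Prop := exists x, y = (b * x + j)%E.

Lemma hecke_residue_classes_sum m b (js : list eisenstein) : b <> 0%E ->
  exists K, forall s L, 1 < s <= 2 -> has_sum (hecke m s) L ->
    exists S, has_sum (fun y => lsum (fun j => restrict (residue_class b j) (hecke m s) y) js) S /\
      Cmod (S - RtoC (INR (length js)) * (hecke m s b * L)) <= K.
Proof.
  intros Hb. induction js as [|j js (K & IH)].
  - exists 0. intros s L _ _. exists (RtoC 0). split; [exact (has_sum_zero (V := C_NormedModule))|].
    simpl. replace (0 - 0 * (hecke m s b * L))%C with (RtoC 0) by ring. rewrite Cmod_0. lra.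
  - destruct (hecke_residue_class_sum m b j Hb) as (K' & HK').
    exists (K' + K). intros s L Hs HL.
    destruct (IH s L Hs HL) as (S & HS & BS). destruct (HK' s L Hs HL) as (M & HM & BM).
    exists (M + S)%C. split.
    + apply (has_sum_plus (V := C_NormedModule)
        (restrict (residue_class b j) (hecke m s)) _ M S); auto.
      apply (has_sum_image (V := C_NormedModule) (fun x => b * x + j)%E); auto.
      apply affine_injective; auto.
    + change (length (j :: js)) with (Datatypes.S (length js)). rewrite S_INR, RtoC_plus.
      replace (M + S - (RtoC (INR (length js)) + RtoC 1) * (hecke m s b * L))%C
        with ((M - hecke m s b * L) + (S - RtoC (INR (length js)) * (hecke m s b * L)))%C by ring.
      eapply Rle_trans; [apply Cmod_triangle | lra].
Qed.

Lemma L_series_dilation_error m b J : b <> 0%E -> residue_system b J ->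
  exists K, forall s L, 1 < s <= 2 -> has_sum (hecke m s) L ->
    Cmod (L - RtoC (INR (length J)) * (hecke m s b * L)) <= K.
Proof.
  intros Hb (covers & NJ & distinct).
  destruct (hecke_residue_classes_sum m b J Hb) as (K & HK). exists K. intros s L Hs HL.
  destruct (HK s L Hs HL) as (S & HS & BS).
  replace L with S at 1; auto. apply (has_sum_unique (hecke m s)); auto.
  eapply has_sum_ext; [|apply HS]. intros y.
  destruct (covers y) as (j & x & Hj & Hy).
  rewrite (lsum_single _ J j NJ Hj).
  - apply restrict_in. exists x; auto.
  - intros i Hi Hne. apply restrict_out. intros (z & Hz). apply Hne.
    apply (distinct i j z x Hi Hj). congruence.
Qed.

Lemma Im_le_Cmod_1_minus (u : C) (c : R) : Cmod u = 1 -> Rabs (Im u) <= Cmod (1 - RtoC c * u).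
Proof.
  intros Hu. assert (Cconj u - RtoC c = Cconj u * (1 - RtoC c * u))%C as E.
  { transitivity (Cconj u - RtoC c * (u * Cconj u))%C; [|ring].
    rewrite <- Cmod2_conj, Hu, pow1. ring. }
  replace (Cmod (1 - RtoC c * u)) with (Cmod (Cconj u - RtoC c))
    by (rewrite E, Cmod_mult, Cmod_conj, Hu; ring).
  eapply Rle_trans; [|eapply Rle_trans; [apply Rmax_r | apply Rmax_Cmod]].
  right. rewrite <- Rabs_Ropp. f_equal. destruct u as [x y]. simpl. ring.
Qed.

Lemma Im_toC_pow m x : x <> 0%E ->
  Im (toC (x ^ (6 * m))) = Cmod (toC x) ^ (6 * m) * Im (chi m x).
Proof.
  intros Hx. rewrite toC_pow, <- (Cmod_mult_dir (toC x)) at 1 by (apply toC_neq_0; auto).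
  rewrite Cpow_mult_l, <- RtoC_pow. unfold chi. destruct (dir (toC x) ^ (6 * m))%C. simpl. ring.
Qed.

(* Modulo 7, on the multiples of the prime [2 + omega], multiplication by [2 + omega] acts on the
   second coordinate as multiplication by 5. *)
Lemma snd_pow_2_omega n :
  let y := ((2, 1)%Z ^ S n)%E in (7 | fst y - 2 * snd y)%Z /\ ~ (7 | snd y)%Z.
Proof.
  induction n as [|n IH].
  - simpl. split; [exists 0%Z; reflexivity | intros [k Hk]; lia].
  - set (y := ((2, 1)%Z ^ S n)%E) in *. change ((2, 1)%Z ^ S (S n))%E with ((2, 1)%Z * y)%E.
    destruct y as [a b]. cbn [fst snd emul] in *. destruct IH as [[k Hk] Hb]. split.
    + exists (- b)%Z. lia.
    + intros [i Hi]. apply Hb. exists (3 * i - 3 * k - 2 * b)%Z. lia.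
Qed.

Lemma Im_chi_2_omega m : (1 <= m)%nat -> Im (chi m (2, 1)%Z) <> 0.
Proof.
  intros Hm E. pose proof (Im_toC_pow m (2, 1)%Z ltac:(discriminate)) as H.
  rewrite E, Rmult_0_r, toC_pair in H.
  unfold Im in H; cbn [snd] in H. apply Rmult_integral in H as [H|H].
  - apply eq_IZR in H. replace (6 * m)%nat with (S (6 * m - 1)) in H by lia.
    apply (proj2 (snd_pow_2_omega (6 * m - 1))). rewrite H. apply Z.divide_0_r.
  - pose proof (sqrt_lt_R0 3). lra.
Qed.

Lemma L_series_bounded m : (1 <= m)%nat ->
  exists K, forall s L, 1 < s <= 2 -> has_sum (hecke m s) L -> Cmod L <= K.
Proof.
  intros Hm. set (b := (2, 1)%Z : eisenstein).
  assert (b <> 0%E) as Hb by discriminate.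
  destruct (exists_residue_system b Hb) as (J & HJ).
  destruct (L_series_dilation_error m b J Hb HJ) as (K & HK).
  pose proof (Rabs_pos_lt _ (Im_chi_2_omega m Hm)) as Im_pos. fold b in Im_pos.
  exists (K / Rabs (Im (chi m b))). intros s L Hs HL. specialize (HK s L Hs HL).
  replace (L - RtoC (INR (length J)) * (hecke m s b * L))%C
    with ((1 - RtoC (INR (length J) * nweight s b) * chi m b) * L)%C in HK
    by (unfold hecke; rewrite RtoC_mult; ring).
  rewrite Cmod_mult in HK.
  apply (Rmult_le_reg_l (Rabs (Im (chi m b)))); auto.
  replace (Rabs (Im (chi m b)) * (K / Rabs (Im (chi m b)))) with K by (field; lra).
  eapply Rle_trans; [|apply HK]. apply Rmult_le_compat_r; [apply Cmod_ge_0|].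
  apply Im_le_Cmod_1_minus, Cmod_chi; auto.
Qed.

(** * Divergence of the trivial L-series at 1 *)

Definition lattice_row (n : nat) : list eisenstein :=
  map (fun i => (Z.of_nat n, Z.of_nat i)) (seq 0 n).

Fixpoint lattice_triangle (n : nat) : list eisenstein :=
  match n with
  | O => nil
  | S n' => lattice_row n ++ lattice_triangle n'
  end.

Lemma lattice_row_fst n x : In x (lattice_row n) -> fst x = Z.of_nat n.
Proof. intros H. apply in_map_iff in H as (i & <- & _). reflexivity. Qed.

Lemma lattice_triangle_fst n x : In x (lattice_triangle n) -> (fst x <= Z.of_nat n)%Z.
Proof.
  induction n as [|n IH]; cbn [lattice_triangle]; intros H; [destruct H|].
  apply in_app_or in H as [H|H]; [apply lattice_row_fst in H | apply IH in H]; lia.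
Qed.

Lemma lattice_triangle_NoDup n : NoDup (lattice_triangle n).
Proof.
  induction n as [|n IH]; cbn [lattice_triangle]; [constructor|].
  apply NoDup_app; auto.
  - apply FinFun.Injective_map_NoDup; [|apply seq_NoDup].
    intros i j H. injection H; lia.
  - intros x H H'. apply lattice_row_fst in H. apply lattice_triangle_fst in H'. lia.
Qed.

Lemma lattice_row_sum n : (1 <= n)%nat ->
  / INR n / 3 <= lsum (nweight 1) (lattice_row n).
Proof.
  intros Hn. unfold lattice_row. rewrite lsum_map.
  assert (1 <= INR n) as n_ge_1 by (apply (le_INR 1); auto).
  apply Rle_trans with (lsum (fun _ : nat => / (3 * INR n ^ 2)) (seq 0 n)).
  { rewrite lsum_Rconst, length_seq. right. field. lra. }
  apply lsum_le. intros i Hi. apply in_seq in Hi.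
  assert ((Z.of_nat n, Z.of_nat i) <> 0%E) as neq_0 by (intros H; injection H; lia).
  pose proof (enorm_ge_1 _ neq_0).
  rewrite nweight_neq_0, Rpower_Ropp, Rpower_1 by (auto; lra).
  apply Rinv_le_contravar; [lra|].
  replace (3 * INR n ^ 2) with (3 * (INR n * INR n)) by ring.
  rewrite INR_IZR_INZ, <- !mult_IZR. apply IZR_le. unfold enorm; cbn [fst snd]. nia.
Qed.

Lemma lattice_triangle_sum n : ln (1 + INR n) / 3 <= lsum (nweight 1) (lattice_triangle n).
Proof.
  induction n as [|n IH].
  - simpl INR. rewrite Rplus_0_r, ln_1. right. apply Rmult_0_l.
  - cbn [lattice_triangle]. rewrite lsum_Rapp. pose proof (lattice_row_sum (S n) ltac:(lia)) as row.
    pose proof (pos_INR n). rewrite (Rplus_comm 1 (INR n)) in IH. rewrite S_INR in *.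
    set (N := INR n + 1) in *. assert (1 <= N) as N_ge_1 by (unfold N; lra).
    assert (ln (1 + N) - ln N <= / N).
    { pose proof (exp_ineq1_le (ln ((1 + N) / N))) as E.
      rewrite exp_ln in E by (apply Rdiv_lt_0_compat; lra). rewrite ln_div in E by lra.
      replace ((1 + N) / N) with (1 + / N) in E by (field; lra). lra. }
    lra.
Qed.

Lemma lsum_nweight_1_unbounded K : exists l, NoDup l /\ K <= lsum (nweight 1) l.
Proof.
  destruct (INR_unbounded (exp (3 * K))) as (n & Hn).
  exists (lattice_triangle n); split; [apply lattice_triangle_NoDup|].
  eapply Rle_trans; [|apply lattice_triangle_sum].
  assert (3 * K <= ln (1 + INR n)); [|lra].
  rewrite <- (ln_exp (3 * K)). apply ln_le; [apply exp_pos | lra].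
Qed.

Lemma continuous_lsum_nweight l s : continuous (fun s => lsum (nweight s) l) s.
Proof.
  induction l as [|x l IH]; [apply continuous_const|].
  apply (continuous_plus (fun s => nweight s x) (fun s => lsum (nweight s) l)); auto.
  unfold nweight. destruct Z.eq_dec; [apply continuous_const|].
  unfold Rpower. apply (ex_derive_continuous (K := R_AbsRing) (V := R_NormedModule)).
  auto_derive. auto.
Qed.

Lemma trivial_L_series_unbounded K :
  exists s, 1 < s <= 2 /\ forall L, has_sum (hecke 0 s) L -> K <= Cmod L.
Proof.
  destruct (lsum_nweight_1_unbounded (K + 1)) as (l & Nl & Hl).
  destruct (continuous_lsum_nweight l 1 (fun y => K < y)) as ([e He] & near).
  { apply (open_gt K). lra. }
  pose proof (Rmin_l (e / 2) 1). pose proof (Rmin_r (e / 2) 1).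
  assert (0 < Rmin (e / 2) 1) by (apply Rmin_glb_lt; lra).
  exists (1 + Rmin (e / 2) 1). split; [lra|]. intros L HL.
  apply Rle_trans with (lsum (nweight (1 + Rmin (e / 2) 1)) l).
  - left. apply near.
    change (Rabs (1 + Rmin (e / 2) 1 - 1) < e). rewrite Rabs_pos_eq; lra.
  - apply lsum_le_Cmod_sum; auto; [apply nweight_nonneg|].
    apply (has_sum_ext (hecke 0 (1 + Rmin (e / 2) 1))); auto. apply hecke_trivial.
Qed.

(** * Sieving by finitely many primes *)

Definition cprod {T : Type} (f : T -> C) (l : list T) : C := iter Cmult (RtoC 1) l f.

Lemma cprod_cons {T} (f : T -> C) x l : cprod f (x :: l) = (f x * cprod f l)%C.
Proof. reflexivity. Qed.

Lemma Cmod_cprod_1_minus_sqr_le {T} (z : T -> C) l :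
  Cmod (cprod (fun x => 1 - z x)%C l) ^ 2 <=
    exp (lsum (fun x => Cmod (z x) ^ 2) l - 2 * lsum (fun x => Re (z x)) l).
Proof.
  induction l as [|x l IH].
  - change (Cmod 1 ^ 2 <= exp (0 - 2 * 0)). rewrite Cmod_1, Rmult_0_r, Rminus_0_r, exp_0. lra.
  - assert (Cmod (1 - z x) ^ 2 <= exp (Cmod (z x) ^ 2 - 2 * Re (z x))) as factor.
    { eapply Rle_trans; [|apply exp_ineq1_le]. rewrite !Cmod2_alt.
      destruct (z x) as [a b]. simpl. right; ring. }
    rewrite cprod_cons, Cmod_mult, Rpow_mult_distr, !lsum_Rcons.
    replace (Cmod (z x) ^ 2 + lsum (fun x => Cmod (z x) ^ 2) l -
        2 * (Re (z x) + lsum (fun x => Re (z x)) l))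
      with (Cmod (z x) ^ 2 - 2 * Re (z x) +
        (lsum (fun x => Cmod (z x) ^ 2) l - 2 * lsum (fun x => Re (z x)) l)) by ring.
    rewrite exp_plus. apply Rmult_le_compat; auto; apply pow2_ge_0.
Qed.

Lemma exp_le_Cmod_cprod_1_minus {T} (r : T -> R) l : (forall x, In x l -> 0 <= r x <= 1 / 2) ->
  exp (- (2 * lsum r l)) <= Cmod (cprod (fun x => 1 - RtoC (r x))%C l).
Proof.
  induction l as [|x l IH]; intros Hr.
  - change (exp (- (2 * 0)) <= Cmod 1). rewrite Cmod_1, Rmult_0_r, Ropp_0, exp_0. lra.
  - pose proof (Hr x (or_introl eq_refl)) as Hx.
    rewrite cprod_cons, Cmod_mult, lsum_Rcons, <- RtoC_minus, Cmod_R, Rabs_pos_eq by lra.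
    replace (- (2 * (r x + lsum r l))) with (- (2 * r x) + - (2 * lsum r l)) by ring.
    rewrite exp_plus. apply Rmult_le_compat; try (left; apply exp_pos).
    + rewrite exp_Ropp. pose proof (exp_ineq1_le (2 * r x)).
      apply (Rmult_le_reg_r (exp (2 * r x))); [apply exp_pos|].
      rewrite Rinv_l by (apply Rgt_not_eq, exp_pos). nra.
    + apply IH. intros y Hy. apply Hr. right; auto.
Qed.

Definition ideal_multiplicative (h : eisenstein -> C) : Prop :=
  (forall x y, h (x * y)%E = (h x * h y)%C) /\ h 0%E = 0 /\
  forall u, enorm u = 1%Z -> h u = 1.

Definition euler_product (h : eisenstein -> C) (P : list eisenstein) : C :=
  cprod (fun p => 1 - h p)%C P.

Definition undivided (P : list eisenstein) (x : eisenstein) : Prop :=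
  forall p, In p P -> ~ edvd p x.

Section Sieve.

Variable h : eisenstein -> C.
Hypothesis h_mult : ideal_multiplicative h.

Lemma restrict_undivided_mul P p x : nonassociated_primes (p :: P) ->
  restrict (undivided P) h (p * x)%E = (h p * restrict (undivided P) h x)%C.
Proof.
  intros HP. apply nonassociated_primes_cons in HP as (_ & Hp & HP & _).
  destruct (classic (undivided P x)) as [Hx|Hx].
  - rewrite !restrict_in; [apply h_mult | auto |].
    intros q Hq D. destruct (HP q Hq) as (_ & _ & Pq).
    destruct (Pq p x D); [apply (Hp q) | apply (Hx q)]; auto.
  - rewrite !restrict_out; auto; [symmetry; apply Cmult_0_r|].
    intros H. apply Hx. intros q Hq D. apply (H q Hq), edvd_mul_l, D.
Qed.

Lemma restrict_undivided_cons P p x : restrict (undivided (p :: P)) h x =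
  minus (restrict (undivided P) h x) (restrict (edvd p) (restrict (undivided P) h) x).
Proof.
  destruct (classic (edvd p x)) as [D|D].
  - rewrite restrict_out, (restrict_in (edvd p)); auto.
    + symmetry. apply (minus_eq_zero (G := C_AbelianGroup)).
    + intros H. apply (H p); simpl; auto.
  - rewrite (restrict_out (edvd p)) by auto.
    transitivity (restrict (undivided P) h x).
    + destruct (classic (undivided P x)) as [Hx|Hx].
      * rewrite !restrict_in; auto. intros q [<-|Hq]; auto.
      * rewrite !restrict_out; auto. intros H. apply Hx. intros q Hq. apply H. right; auto.
    + symmetry. apply (minus_zero_r (G := C_AbelianGroup)).
Qed.

Lemma has_sum_undivided P L : nonassociated_primes P -> has_sum h L ->
  has_sum (restrict (undivided P) h) (L * euler_product h P)%C.
Proof.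
  intros HP HL. induction P as [|p P IH].
  - replace (L * euler_product h nil)%C with L by (symmetry; apply Cmult_1_r).
    apply (has_sum_ext h); auto. intros x. symmetry. apply restrict_in. intros p [].
  - pose proof HP as HPp. apply nonassociated_primes_cons in HPp as (Hp & _ & HP').
    unfold euler_product in *. rewrite cprod_cons.
    set (M := (L * cprod (fun p => 1 - h p) P)%C) in *.
    replace (L * ((1 - h p) * cprod (fun p => 1 - h p) P))%C with (M - h p * M)%C
      by (unfold M; ring).
    apply (has_sum_ext (fun x => minus (restrict (undivided P) h x)
      (restrict (edvd p) (restrict (undivided P) h) x))).
    { intros x. symmetry. apply restrict_undivided_cons. }
    apply (has_sum_minus (V := C_NormedModule)); auto.
    apply (has_sum_image (V := C_NormedModule) (emul p)).
    + intros x y. apply emul_cancel_l, Hp.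
    + apply (has_sum_ext (fun x => scal (h p) (restrict (undivided P) h x))).
      * intros x. symmetry. apply restrict_undivided_mul; auto.
      * apply (has_sum_scal (V := C_NormedModule)). auto.
Qed.

Lemma lsum_restrict_undivided P l : nonassociated_primes P -> NoDup l -> incl eunits l ->
  (forall x, In x l -> x <> 0%E -> enorm x <> 1%Z -> exists p, In p P /\ edvd p x) ->
  lsum (restrict (undivided P) h) l = RtoC 6.
Proof.
  intros HP Nl Hi HC. destruct h_mult as (_ & h_0 & h_unit).
  destruct (NoDup_incl_split eunits l eunits_NoDup Nl Hi) as (l1 & perm_l & _ & disjoint).
  rewrite (lsum_perm _ _ _ perm_l), lsum_app, (lsum_zero _ l1).
  - transitivity (lsum (fun _ : eisenstein => RtoC 1) eunits).
    + rewrite plus_zero_r. apply lsum_ext. intros u Hu. apply enorm_1_iff in Hu.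
      rewrite restrict_in; auto. intros p Hp (z & ->).
      pose proof (enorm_prime_ge_2 p (proj1 HP p Hp)).
      rewrite enorm_mul in Hu. apply Z.mul_eq_1 in Hu. lia.
    + rewrite <- RtoC_lsum, lsum_Rconst. simpl. f_equal. ring.
  - intros x Hx. destruct (classic (x = 0%E)) as [->|x_neq_0].
    + unfold restrict. destruct excluded_middle_informative; auto.
    + destruct (HC x) as (p & Hp & Dp); auto.
      * apply (Permutation_in _ (Permutation_sym perm_l)), in_or_app. auto.
      * intros H. apply (disjoint x Hx), enorm_1_iff, H.
      * apply restrict_out. intros H. apply (H p); auto.
Qed.

End Sieve.

Lemma exists_sieve (w : eisenstein -> R) e : summable w -> 0 < e ->
  exists P, nonassociated_primes P /\ forall h L, ideal_multiplicative h ->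
    (forall x, Cmod (h x) <= w x) -> has_sum h L -> Cmod (L * euler_product h P - 6) <= e.
Proof.
  intros Hw He. destruct (summable_tail w e Hw He) as (l0 & N0 & small_tail).
  destruct (exists_nonassociated_prime_divisors l0) as (P & HP & CP).
  exists P. split; auto. intros h L Hh dominated HL.
  set (l := nodup classical_eq_dec (l0 ++ eunits)).
  assert (In_l : forall x, In x l <-> In x l0 \/ In x eunits).
  { intros x. unfold l. rewrite nodup_In. apply in_app_iff. }
  assert (NoDup l) as Nl by apply NoDup_nodup.
  rewrite <- (lsum_restrict_undivided h Hh P l); auto.
  - apply (has_sum_tail (V := C_NormedModule) _ _ _ _ Nl (has_sum_undivided h Hh P L HP HL)).
    intros l1 N1 disjoint. eapply Rle_trans; [apply (norm_lsum_le (V := C_NormedModule))|].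
    apply Rle_trans with (lsum w l1).
    + apply lsum_le. intros x _. change (Cmod (restrict (undivided P) h x) <= w x).
      unfold restrict. destruct excluded_middle_informative; auto.
      change (Cmod 0 <= w x). rewrite Cmod_0. apply Hw.
    + apply small_tail; auto. intros x Hx Hx0. apply (disjoint x Hx), In_l. auto.
  - intros u Hu. apply In_l. auto.
  - intros x Hx x_neq_0 x_nonunit. apply In_l in Hx as [Hx|Hx]; auto.
    apply enorm_1_iff in Hx. tauto.
Qed.

(** * Character sums over primes *)

Lemma hecke_ideal_multiplicative m s : ideal_multiplicative (hecke m s).
Proof. split; [apply hecke_mul|]. split; [apply hecke_0 | apply hecke_unit]. Qed.

Lemma nweight_sqr s x : nweight s x ^ 2 = nweight (2 * s) x.
Proof.
  destruct (classic (x = 0%E)) as [->|Hx]; [rewrite !nweight_0; ring|].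
  rewrite !nweight_neq_0 by auto. simpl. rewrite Rmult_1_r, <- Rpower_plus. f_equal. ring.
Qed.

Lemma nweight_prime_le_half s p : 1 <= s -> eprime p -> nweight s p <= 1 / 2.
Proof.
  intros Hs Hp. pose proof (IZR_le _ _ (enorm_prime_ge_2 p Hp)).
  eapply Rle_trans; [apply (nweight_antitone 1); auto|].
  rewrite nweight_neq_0, Rpower_Ropp, Rpower_1 by (lra || apply Hp).
  unfold Rdiv. rewrite Rmult_1_l. apply Rinv_le_contravar; lra.
Qed.

Definition sieves (s : R) (P : list eisenstein) : Prop :=
  nonassociated_primes P /\
  forall m L, has_sum (hecke m s) L -> Cmod (L * euler_product (hecke m s) P - 6) <= 1.

Lemma exists_sieves s : 1 < s -> exists P, sieves s P.
Proof.
  intros Hs. destruct (exists_sieve (nweight s) 1) as (P & HP & near_6); [|lra|].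
  - apply nweight_summable; auto.
  - exists P. split; auto. intros m L HL. apply near_6; auto.
    + apply hecke_ideal_multiplicative.
    + intros x. rewrite Cmod_hecke. lra.
Qed.

Lemma sieves_Cmod_bounds s P m L : sieves s P -> has_sum (hecke m s) L ->
  5 <= Cmod L * Cmod (euler_product (hecke m s) P) <= 7.
Proof.
  intros [_ near_6] HL. specialize (near_6 m L HL). rewrite <- Cmod_mult.
  pose proof (Cmod_minus_ge (L * euler_product (hecke m s) P) 6) as H.
  apply Rabs_le_between in H. rewrite Cmod_R, (Rabs_pos_eq 6) in H by lra. lra.
Qed.

Definition prime_character_sum (m : nat) (s : R) (P : list eisenstein) : R :=
  lsum (fun p => Re (chi m p) * nweight s p) P.

(* The Euler product bounds [exp (2 S)] by a constant times [Cmod L ^ 2], where [S] is the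
   character sum over the sieving primes. *)
Lemma prime_character_sum_le m : (1 <= m)%nat ->
  exists K, forall s P, 1 < s <= 2 -> sieves s P ->
    prime_character_sum m s P <= K.
Proof.
  intros Hm. destruct (L_series_bounded m Hm) as (K & HK).
  destruct (nweight_summable 2) as (_ & W & HW); [lra|].
  exists (K ^ 2 * exp W). intros s P Hs HP.
  destruct (hecke_has_sum m s) as (L & HL); [lra|].
  pose proof (proj1 (sieves_Cmod_bounds s P m L HP HL)) as ge_5.
  specialize (HK s L Hs HL).
  set (S := prime_character_sum m s P).
  set (e := Cmod (euler_product (hecke m s) P)) in *.
  assert (e ^ 2 <= exp W * / exp (2 * S)) as euler_le.
  { rewrite <- exp_Ropp, <- exp_plus. eapply Rle_trans; [apply Cmod_cprod_1_minus_sqr_le|].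
    rewrite (lsum_ext (fun p => Re (hecke m s p)) (fun p => Re (chi m p) * nweight s p))
      by (intros; apply Re_hecke). fold (prime_character_sum m s P). fold S.
    assert (lsum (fun p => Cmod (hecke m s p) ^ 2) P <= W).
    { eapply Rle_trans; [|apply (HW P), nonassociated_primes_NoDup, HP].
      apply lsum_le. intros p _. rewrite Cmod_hecke, nweight_sqr.
      apply nweight_antitone. lra. }
    apply exp_le_compat. lra. }
  apply (Rmult_le_compat_r (exp (2 * S))) in euler_le; [|left; apply exp_pos].
  rewrite Rmult_assoc, Rinv_l, Rmult_1_r in euler_le by (apply Rgt_not_eq, exp_pos).
  assert (25 * exp (2 * S) <= K ^ 2 * exp W).
  { pose proof (Cmod_ge_0 L). pose proof (exp_pos (2 * S)). pose proof (exp_pos W).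
    assert (Cmod L ^ 2 <= K ^ 2) by (apply pow_incr; auto).
    assert (25 <= Cmod L ^ 2 * e ^ 2) by nra.
    apply Rle_trans with (Cmod L ^ 2 * (e ^ 2 * exp (2 * S))); [nra|].
    apply Rmult_le_compat; auto; [apply pow2_ge_0|].
    apply Rmult_le_pos; [apply pow2_ge_0 | lra]. }
  pose proof (exp_ineq1_le (2 * S)). pose proof (exp_pos (2 * S)). lra.
Qed.

Lemma prime_character_sums_le M :
  exists K, forall m s P, (1 <= m <= M)%nat -> 1 < s <= 2 -> sieves s P ->
    prime_character_sum m s P <= K.
Proof.
  induction M as [|M (K & HK)]; [exists 0; intros; lia|].
  destruct (prime_character_sum_le (S M)) as (K' & HK'); [lia|].
  exists (Rmax K K'). intros m s P Hm Hs HP. destruct (Nat.eq_dec m (S M)) as [->|Hne].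
  - eapply Rle_trans; [apply HK' | apply Rmax_r]; auto.
  - eapply Rle_trans; [apply HK | apply Rmax_l]; auto. lia.
Qed.

Lemma prime_weights_unbounded T :
  exists s P, 1 < s <= 2 /\ sieves s P /\ T <= lsum (nweight s) P.
Proof.
  destruct (trivial_L_series_unbounded (8 * exp (2 * T))) as (s & Hs & unbounded).
  destruct (exists_sieves s) as (P & HP); [lra|].
  exists s, P. split; auto. split; auto.
  destruct (hecke_has_sum 0 s) as (L & HL); [lra|].
  pose proof (proj2 (sieves_Cmod_bounds s P 0 L HP HL)) as le_7. specialize (unbounded L HL).
  assert (exp (- (2 * lsum (nweight s) P)) <= Cmod (euler_product (hecke 0 s) P)) as euler_ge.
  { replace (euler_product (hecke 0 s) P) with (cprod (fun p => 1 - RtoC (nweight s p))%C P).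
    - apply exp_le_Cmod_cprod_1_minus. intros p Hp. split; [apply nweight_nonneg|].
      apply nweight_prime_le_half; [lra | apply HP; auto].
    - apply iter_ext. intros p _. rewrite hecke_trivial. reflexivity. }
  apply Rnot_lt_le. intros Hlt.
  assert (1 <= exp (2 * T) * exp (- (2 * lsum (nweight s) P))).
  { rewrite <- exp_plus, <- exp_0. apply exp_le_compat. lra. }
  pose proof (exp_pos (2 * T)). pose proof (exp_pos (- (2 * lsum (nweight s) P))). nra.
Qed.

(** * A detecting trigonometric polynomial *)

(* Pascal's rule: the weight of [f j] is the binomial coefficient of [n] and [j]. *)
Fixpoint binom_sum (n : nat) (f : nat -> R) : R :=
  match n with
  | O => f O
  | S n' => binom_sum n' f + binom_sum n' (fun j => f (S j))
  end.

Lemma binom_sum_ext n f g : (forall j, f j = g j) -> binom_sum n f = binom_sum n g.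
Proof.
  revert f g. induction n as [|n IH]; intros f g H; [apply H|]. simpl.
  f_equal; apply IH; intros; apply H.
Qed.

Lemma binom_sum_le n f g :
  (forall j, (j <= n)%nat -> f j <= g j) -> binom_sum n f <= binom_sum n g.
Proof.
  revert f g. induction n as [|n IH]; intros f g H; [apply H; lia|]. simpl.
  apply Rplus_le_compat; apply IH; intros; apply H; lia.
Qed.

Lemma binom_sum_plus n f g :
  binom_sum n (fun j => f j + g j) = binom_sum n f + binom_sum n g.
Proof.
  revert f g. induction n as [|n IH]; intros f g; [reflexivity|]. simpl. rewrite !IH. ring.
Qed.

Lemma binom_sum_scal n c f : binom_sum n (fun j => c * f j) = c * binom_sum n f.
Proof. revert f. induction n as [|n IH]; intros f; [reflexivity|]. simpl. rewrite !IH. ring. Qed.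

Lemma binom_sum_succ n f : binom_sum (S n) f = binom_sum n (fun j => f j + f (S j)).
Proof. symmetry. apply binom_sum_plus. Qed.

Lemma lsum_binom_sum {T} n (f : T -> nat -> R) l :
  lsum (fun x => binom_sum n (f x)) l = binom_sum n (fun j => lsum (fun x => f x j) l).
Proof.
  revert f. induction n as [|n IH]; intros f; [reflexivity|]. simpl.
  rewrite lsum_Rplus, IH. f_equal. apply IH.
Qed.

Lemma binom_sum_index n f :
  binom_sum (S n) (fun j => INR j * f j) = INR (S n) * binom_sum n (fun j => f (S j)).
Proof.
  revert f. induction n as [|n IH]; intros f; [simpl; ring|].
  rewrite binom_sum_succ, (binom_sum_ext _ _ (fun j => INR j * (f j + f (S j)) + f (S j)))
    by (intros; rewrite S_INR; ring).
  rewrite binom_sum_plus, IH, (S_INR (S n)).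
  rewrite (binom_sum_succ n (fun j => f (S j))). ring.
Qed.

Lemma binom_sum_coindex n f :
  binom_sum (S n) (fun j => (INR (S n) - INR j) * f j) = INR (S n) * binom_sum n f.
Proof.
  revert f. induction n as [|n IH]; intros f; [simpl; ring|].
  rewrite binom_sum_succ,
    (binom_sum_ext _ _ (fun j => (INR (S n) - INR j) * (f j + f (S j)) + f j))
    by (intros; rewrite !S_INR; ring).
  rewrite binom_sum_plus, IH, (S_INR (S n)), (binom_sum_succ n f). ring.
Qed.

Lemma binom_sum_index_coindex n f :
  binom_sum (S (S n)) (fun j => INR j * (INR (S (S n)) - INR j) * f j) =
    INR (S (S n)) * INR (S n) * binom_sum n (fun j => f (S j)).
Proof.
  rewrite (binom_sum_ext _ _ (fun j => INR j * ((INR (S (S n)) - INR j) * f j)))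
    by (intros; ring).
  rewrite binom_sum_index,
    (binom_sum_ext _ _ (fun j => (INR (S n) - INR j) * f (S j)))
    by (intros; rewrite !S_INR; ring).
  rewrite binom_sum_coindex. ring.
Qed.

Lemma binom_sum_cos n t x :
  binom_sum n (fun j => cos (t + INR j * x)) = (2 * cos (x / 2)) ^ n * cos (t + INR n * (x / 2)).
Proof.
  revert t. induction n as [|n IH]; intros t.
  - simpl. rewrite !Rmult_0_l. ring.
  - cbn [binom_sum]. rewrite IH.
    rewrite (binom_sum_ext n _ (fun j => cos (t + x + INR j * x)))
      by (intros; rewrite S_INR; f_equal; ring).
    rewrite IH, S_INR, <- tech_pow_Rmult.
    set (a := t + (INR n + 1) * (x / 2)).
    replace (t + INR n * (x / 2)) with (a - x / 2) by (unfold a; field).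
    replace (t + x + INR n * (x / 2)) with (a + x / 2) by (unfold a; field).
    rewrite cos_minus, cos_plus. ring.
Qed.

Definition centered (n j : nat) : R := INR j - INR n.

Lemma binom_sum_centered_cos n x :
  binom_sum (2 * n) (fun j => cos (centered n j * x)) = (2 + 2 * cos x) ^ n.
Proof.
  rewrite (binom_sum_ext _ _ (fun j => cos (- (INR n * x) + INR j * x)))
    by (intros; unfold centered; f_equal; ring).
  rewrite binom_sum_cos, pow_mult, mult_INR.
  replace (- (INR n * x) + INR 2 * INR n * (x / 2)) with 0 by (simpl; field).
  rewrite cos_0, Rmult_1_r. f_equal.
  replace x with (2 * (x / 2)) at 2 by field. rewrite cos_2a_cos. ring.
Qed.

(* With [g x = (2 + 2 * cos x) ^ n], this is [- g'' x - g x]. *)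
Definition detector (n : nat) (x : R) : R :=
  binom_sum (2 * n) (fun j => (centered n j ^ 2 - 1) * cos (centered n j * x)).

Definition central (n : nat) : R :=
  binom_sum (2 * n) (fun j => if Nat.eqb j n then 1 else 0).

Lemma detector_succ n x : detector (S n) x =
  (2 + 2 * cos x) ^ n *
    (INR n * (INR n + 2) * (2 + 2 * cos x) - (2 * INR n + 2) * (2 * INR n + 1)).
Proof.
  unfold detector.
  rewrite (binom_sum_ext _ _ (fun j =>
    INR n * (INR n + 2) * cos (centered (S n) j * x) +
    - (1) * (INR j * (INR (2 * S n) - INR j) * cos (centered (S n) j * x)))).
  2:{ intros j. unfold centered. rewrite mult_INR, S_INR. change (INR 2) with 2. ring. }
  rewrite binom_sum_plus, !binom_sum_scal, binom_sum_centered_cos.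
  replace (2 * S n)%nat with (S (S (2 * n))) by lia.
  rewrite binom_sum_index_coindex.
  rewrite (binom_sum_ext _ _ (fun j => cos (centered n j * x)))
    by (intros; unfold centered; rewrite !S_INR; do 2 f_equal; ring).
  rewrite binom_sum_centered_cos, <- tech_pow_Rmult, !S_INR, mult_INR. change (INR 2) with 2. ring.
Qed.

Lemma detector_nonneg n x : (2 <= n)%nat -> cos x = 1 -> 0 <= detector n x.
Proof.
  intros Hn Hx. destruct n as [|n]; [lia|]. rewrite detector_succ, Hx.
  assert (1 <= INR n) by (apply (le_INR 1); lia).
  apply Rmult_le_pos; [apply pow_le; lra | nra].
Qed.

Lemma detector_succ_lower n x c : cos x <= c ->
  - ((2 + 2 * c) ^ n * ((2 * INR n + 2) * (2 * INR n + 1))) <= detector (S n) x.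
Proof.
  intros Hc. rewrite detector_succ. pose proof (COS_bound x) as B. pose proof (pos_INR n).
  assert (0 <= (2 + 2 * cos x) ^ n <= (2 + 2 * c) ^ n).
  { split; [apply pow_le; lra | apply pow_incr; lra]. }
  assert (0 <= INR n * (INR n + 2) * (2 + 2 * cos x)) by (repeat apply Rmult_le_pos; lra).
  assert (0 <= (2 * INR n + 2) * (2 * INR n + 1)) by (apply Rmult_le_pos; lra).
  nra.
Qed.

Lemma central_succ n : (INR n + 1) * central (S n) = 2 * (2 * INR n + 1) * central n.
Proof.
  assert ((INR n + 1) ^ 2 * central (S n) =
    (2 * INR n + 2) * (2 * INR n + 1) * central n) as H.
  { unfold central.
    rewrite <- binom_sum_scal.
    rewrite (binom_sum_ext _ _ (fun j =>
      INR j * (INR (S (S (2 * n))) - INR j) * (if Nat.eqb j (S n) then 1 else 0))).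
    - replace (2 * S n)%nat with (S (S (2 * n))) by lia.
      rewrite binom_sum_index_coindex, !S_INR, mult_INR. change (INR 2) with 2.
      replace (2 * INR n + 1 + 1) with (2 * INR n + 2) by ring. reflexivity.
    - intros j. destruct (Nat.eqb_spec j (S n)) as [->|]; [|ring].
      rewrite !S_INR, mult_INR. change (INR 2) with 2. ring. }
  pose proof (pos_INR n). apply (Rmult_eq_reg_l (INR n + 1)); [|lra].
  transitivity ((INR n + 1) ^ 2 * central (S n)); [ring|]. rewrite H. ring.
Qed.

Lemma central_lower n : 4 ^ n <= (2 * INR n + 1) * central n.
Proof.
  induction n as [|n IH]; [unfold central; simpl; lra|].
  pose proof (central_succ n) as E. pose proof (pos_INR n). pose proof (pow_lt 4 n ltac:(lra)).
  rewrite S_INR, <- tech_pow_Rmult.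
  assert (0 <= central (S n)) by nra. nra.
Qed.

Lemma is_lim_seq_pow_geom d q : 0 < q < 1 -> is_lim_seq (fun n => INR n ^ d * q ^ n) 0.
Proof.
  intros Hq. destruct d as [|d].
  { apply (is_lim_seq_ext (fun n => q ^ n)); [intros; simpl; ring|].
    apply is_lim_seq_geom. rewrite Rabs_pos_eq; lra. }
  pose proof (ln_increasing q 1 ltac:(lra) ltac:(lra)) as Hl. rewrite ln_1 in Hl.
  set (e := INR (S d)). assert (0 < e) as He by apply lt_0_INR, Nat.lt_0_succ.
  set (y := fun n => ln q / e * INR n).
  assert (is_lim_seq (fun n => y n * exp (y n)) 0) as lim_y.
  { apply (is_lim_comp_seq (fun u => u * exp u) y m_infty 0); [exact is_lim_mul_exp_m | |].
    - exists O. intros n _. discriminate.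
    - assert (is_lim_seq y (Rbar_mult (ln q / e) p_infty)) as H.
      { apply is_lim_seq_scal_l, is_lim_seq_INR. }
      replace (Rbar_mult (ln q / e) p_infty) with m_infty in H; auto.
      symmetry. apply is_Rbar_mult_unique, is_Rbar_mult_sym, is_Rbar_mult_p_infty_neg.
      apply Rdiv_neg_pos; auto. }
  replace (Finite 0) with (Finite ((e / ln q) ^ S d * 0 ^ S d)) by (f_equal; simpl; ring).
  apply (is_lim_seq_ext (fun n => (e / ln q) ^ S d * (y n * exp (y n)) ^ S d)).
  - intros n. rewrite <- Rpow_mult_distr.
    replace (e / ln q * (y n * exp (y n))) with (INR n * exp (y n)) by (unfold y; field; lra).
    rewrite Rpow_mult_distr. f_equal.
    rewrite <- !Rpower_pow by (try apply exp_pos; lra). unfold Rpower. rewrite ln_exp.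
    f_equal. fold e. unfold y. field. lra.
  - apply (is_lim_seq_scal_l (fun n => (y n * exp (y n)) ^ S d) _ (0 ^ S d)).
    apply (is_lim_seq_continuous (fun u => u ^ S d)); auto.
    apply derivable_continuous_pt, derivable_pt_pow.
Qed.

Lemma exists_detector c : 0 <= c < 1 -> exists n, (2 <= n)%nat /\
  forall x, cos x <= c -> - (central n / 2) <= detector n x.
Proof.
  intros Hc. set (q := (1 + c) / 2). assert (0 < q < 1) as Hq by (unfold q; lra).
  destruct (is_lim_seq_pow_geom 3 q Hq (fun u => u < 1 / 30)) as (N & HN).
  { apply (open_lt (1 / 30)). lra. }
  exists (S (S N)). split; [lia|]. intros x Hx.
  specialize (HN (S N) ltac:(lia)).
  set (n := S N) in *. assert (1 <= INR n) as n_ge_1 by (apply (le_INR 1); lia).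
  eapply Rle_trans; [|apply (detector_succ_lower n x c Hx)].
  apply Ropp_le_contravar. pose proof (central_lower (S n)) as central_ge.
  rewrite S_INR, <- tech_pow_Rmult in central_ge.
  replace (2 + 2 * c) with (4 * q) by (unfold q; field). rewrite Rpow_mult_distr.
  pose proof (pow_lt 4 n ltac:(lra)) as four_pos. pose proof (pow_lt q n ltac:(lra)) as q_pos.
  assert ((2 * INR n + 3) * ((2 * INR n + 2) * (2 * INR n + 1)) <= 60 * INR n ^ 3) as cubic.
  { replace (60 * INR n ^ 3) with (5 * INR n * (4 * INR n * (3 * INR n))) by ring.
    repeat apply Rmult_le_compat; try apply Rmult_le_pos; lra. }
  apply (Rmult_le_reg_l (2 * INR n + 3)); [lra|].
  apply Rle_trans with (4 ^ n * (60 * INR n ^ 3 * q ^ n)).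
  - apply (Rmult_le_compat_r (4 ^ n * q ^ n)) in cubic; [nra|]. apply Rmult_le_pos; lra.
  - assert (4 ^ n * (60 * INR n ^ 3 * q ^ n) <= 4 ^ n * 2); [|nra].
    apply Rmult_le_compat_l; lra.
Qed.

(** * Primes of small nonzero argument *)

Lemma Re_chi_cos p : p <> 0%E -> exists x, forall m, Re (chi m p) = cos (INR m * x).
Proof.
  intros Hp. destruct (unit_circle_cis (dir (toC p))) as (t & Ht).
  { apply Cmod_dir, toC_neq_0, Hp. }
  exists (6 * t). intros m. rewrite (chi_polar m p t Ht). reflexivity.
Qed.

(* [(j - n) + (n - j)] is the distance of [j] and [n], as subtraction is truncated. *)
Definition chi_detector (n : nat) (p : eisenstein) : R :=
  binom_sum (2 * n) (fun j => (centered n j ^ 2 - 1) * Re (chi ((j - n) + (n - j)) p)).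

Lemma chi_detector_eq n p : p <> 0%E ->
  exists x, Re (chi 1 p) = cos x /\ chi_detector n p = detector n x.
Proof.
  intros Hp. destruct (Re_chi_cos p Hp) as (x & Hx). exists x.
  split; [rewrite Hx; f_equal; simpl; ring|].
  apply binom_sum_ext. intros j. rewrite Hx, plus_INR. f_equal. unfold centered.
  destruct (Nat.le_ge_cases j n) as [L|L].
  - replace (j - n)%nat with O by lia. rewrite minus_INR, <- cos_neg by auto.
    f_equal. simpl. ring.
  - replace (n - j)%nat with O by lia. rewrite minus_INR by auto. f_equal. simpl. ring.
Qed.

Lemma lsum_chi_detector_le n : exists B, forall s P, 1 < s <= 2 -> sieves s P ->
  lsum (fun p => nweight s p * chi_detector n p) P <= B - central n * lsum (nweight s) P.
Proof.
  destruct (prime_character_sums_le n) as (K & HK).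
  exists (Rabs K * binom_sum (2 * n) (fun j => Rabs (centered n j ^ 2 - 1))).
  intros s P Hs HP. set (W := lsum (nweight s) P).
  rewrite (lsum_ext _ (fun p => binom_sum (2 * n) (fun j =>
    (centered n j ^ 2 - 1) * (Re (chi ((j - n) + (n - j)) p) * nweight s p)))).
  2:{ intros p _. unfold chi_detector. rewrite <- binom_sum_scal.
      apply binom_sum_ext. intros j. ring. }
  rewrite lsum_binom_sum.
  apply Rle_trans with (binom_sum (2 * n) (fun j =>
    Rabs K * Rabs (centered n j ^ 2 - 1) + - W * (if Nat.eqb j n then 1 else 0))).
  - apply binom_sum_le. intros j Hj. rewrite lsum_Rmult_l.
    fold (prime_character_sum ((j - n) + (n - j)) s P).
    pose proof (Rabs_pos K). destruct (Nat.eqb_spec j n) as [->|Hne].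
    + rewrite Nat.sub_diag. unfold centered. replace (INR n - INR n) with 0 by ring.
      replace (prime_character_sum (0 + 0) s P) with W
        by (apply lsum_ext; intros; unfold chi; simpl; ring).
      pose proof (Rabs_pos (0 ^ 2 - 1)). nra.
    + assert (1 <= centered n j ^ 2) as freq.
      { unfold centered. destruct (Nat.lt_gt_cases j n) as [[L|L] _]; auto;
          apply le_INR in L; rewrite S_INR in L; nra. }
      rewrite (Rabs_pos_eq (centered n j ^ 2 - 1)) by lra.
      pose proof (HK ((j - n) + (n - j))%nat s P ltac:(lia) Hs HP) as HKj.
      pose proof (Rle_abs K). nra.
  - rewrite binom_sum_plus, !binom_sum_scal. fold (central n). right. ring.
Qed.

Lemma exists_prime_chi_near_1 c : 0 <= c < 1 -> exists p, eprime p /\ c < Re (chi 1 p) < 1.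
Proof.
  intros Hc. apply NNPP. intros Hno.
  destruct (exists_detector c Hc) as (n & Hn & away).
  destruct (lsum_chi_detector_le n) as (B & HB).
  assert (0 < central n) as Pc.
  { pose proof (central_lower n). pose proof (pow_lt 4 n ltac:(lra)). pose proof (pos_INR n). nra. }
  destruct (prime_weights_unbounded (2 * B / central n + 1)) as (s & P & Hs & HP & HW).
  specialize (HB s P Hs HP). set (W := lsum (nweight s) P) in *.
  assert (- (central n / 2) * W <= lsum (fun p => nweight s p * chi_detector n p) P) as lower.
  { unfold W. rewrite <- lsum_Rmult_l. apply lsum_le. intros p Hp.
    rewrite Rmult_comm. apply Rmult_le_compat_l; [apply nweight_nonneg|].
    pose proof (proj1 (proj1 HP) p Hp) as Pp.
    destruct (chi_detector_eq n p) as (x & Hx & ->); [apply Pp|].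
    destruct (Rle_dec (cos x) c) as [Far|Close]; [apply away; auto|].
    assert (cos x = 1) as Hx1.
    { pose proof (COS_bound x). apply NNPP. intros Hne. apply Hno. exists p. rewrite Hx.
      split; auto. lra. }
    pose proof (detector_nonneg n x Hn Hx1). lra. }
  apply (Rmult_le_compat_r (central n)) in HW; [|lra].
  replace ((2 * B / central n + 1) * central n) with (2 * B + central n) in HW by (field; lra).
  lra.
Qed.

Lemma toC_unit u : enorm u = 1%Z -> exists nu, (nu <= 5)%nat /\ toC u = cis (INR nu * PI / 3).
Proof.
  intros H. apply enorm_1_iff, in_map_iff in H as (nu & <- & Hnu). apply in_seq in Hnu.
  exists nu. split; [lia|]. rewrite toC_pow, toC_omega, cis_pow. f_equal. field.
Qed.

Lemma exists_unit_cis (q : Z) : exists u, enorm u = 1%Z /\ toC u = cis (IZR q * PI / 3).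
Proof.
  pose proof (Z.mod_pos_bound q 6 ltac:(lia)) as B.
  exists (eomega ^ Z.to_nat (q mod 6))%E. split.
  - apply enorm_1_iff, in_map, in_seq. lia.
  - rewrite toC_pow, toC_omega, cis_pow, INR_IZR_INZ, Z2Nat.id by lia.
    rewrite <- (cis_period _ (q / 6)). f_equal.
    rewrite (Z.div_mod q 6) at 3 by lia. rewrite plus_IZR, mult_IZR. field.
Qed.

Lemma angle_mod_2PI x : exists phi (q : Z), x = phi + 2 * IZR q * PI /\ Rabs phi <= PI.
Proof.
  pose proof PI_RGT_0 as P. set (y := x / (2 * PI) + 1 / 2).
  pose proof (Zfloor_bound y) as A.
  assert (x = 2 * PI * (y - 1 / 2)) as Ex by (unfold y; field; lra).
  exists (x - 2 * IZR (Zfloor y) * PI), (Zfloor y). split; [ring|]. apply Rabs_le. nra.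
Qed.

Lemma cos_Rabs x : cos (Rabs x) = cos x.
Proof. unfold Rabs. destruct Rcase_abs; [apply cos_neg | reflexivity]. Qed.

Lemma exists_prime_small_arg d : 0 < d -> exists p r theta,
  eprime p /\ 0 < r /\ toC p = (RtoC r * cis theta)%C /\ 0 < Rabs theta < d.
Proof.
  intros Hd. pose proof PI2_1 as HPI.
  pose proof (Rmin_l d (1 / 6)). pose proof (Rmin_r d (1 / 6)).
  assert (0 < Rmin d (1 / 6)) as He by (apply Rmin_glb_lt; lra).
  set (e := Rmin d (1 / 6)) in *.
  destruct (exists_prime_chi_near_1 (cos (6 * e))) as (p & Hp & near & lt1).
  { split; [apply cos_ge_0; lra|]. rewrite <- cos_0. apply cos_decreasing_1; lra. }
  pose proof (toC_neq_0 p (proj1 Hp)) as toC_p_neq_0.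
  destruct (unit_circle_cis (dir (toC p)) (Cmod_dir _ toC_p_neq_0)) as (t & Ht).
  rewrite (chi_polar 1 p t Ht) in near, lt1. simpl INR in near, lt1. rewrite Rmult_1_l in near, lt1.
  destruct (angle_mod_2PI (6 * t)) as (phi & q & Hphi & Hb).
  rewrite Hphi, cis_period in near, lt1. simpl in near, lt1.
  destruct (exists_unit_cis (- q)) as (u & Hu & Tu).
  exists (u * p)%E, (Cmod (toC p)), (phi / 6).
  split; [apply eprime_unit_mul; auto|]. split; [apply Cmod_gt_0; auto|]. split.
  - rewrite toC_mul, <- (Cmod_mult_dir _ toC_p_neq_0) at 1. rewrite Tu, Ht.
    replace t with (phi / 6 + IZR q * PI / 3) by lra.
    replace (phi / 6) with (IZR (- q) * PI / 3 + (phi / 6 + IZR q * PI / 3)) at 2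
      by (rewrite opp_IZR; field).
    rewrite (cis_plus (IZR (- q) * PI / 3)). ring.
  - rewrite Rabs_div, (Rabs_pos_eq 6) by lra. split.
    + apply Rdiv_lt_0_compat; [|lra]. apply Rabs_pos_lt. intros ->. rewrite cos_0 in lt1. lra.
    + assert (Rabs phi < 6 * e); [|lra]. rewrite <- (cos_Rabs phi) in near.
      apply Rnot_le_lt. intros Hle. pose proof (Rabs_pos phi).
      pose proof (cos_decr_1 (6 * e) (Rabs phi)). lra.
Qed.

(** * Lattice points of norm a power of a prime *)

Lemma cis_inj_near a b : Rabs (a - b) <= PI -> cis a = cis b -> a = b.
Proof.
  intros Hab E. injection E as Ec Es.
  assert (cos (Rabs (a - b)) = 1) as cos_diff.
  { rewrite cos_Rabs, cos_minus, Ec, Es. pose proof (sin2_cos2 b) as H. unfold Rsqr in H. lra. }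
  apply NNPP. intros Hne. pose proof (Rabs_pos_lt (a - b) ltac:(lra)) as Hpos.
  pose proof (cos_decreasing_1 0 (Rabs (a - b))) as decreasing. rewrite cos_0 in decreasing.
  pose proof PI_RGT_0. lra.
Qed.

Definition norm_pow (p : eisenstein) (k : nat) : nat := Z.to_nat (enorm p ^ Z.of_nat k).

Lemma INR_norm_pow p k : INR (norm_pow p k) = IZR (enorm p) ^ k.
Proof.
  unfold norm_pow. rewrite INR_IZR_INZ, Z2Nat.id, <- pow_IZR by (apply Z.pow_nonneg, enorm_nonneg).
  reflexivity.
Qed.

Section PrimePowerNorm.

Variables (p : eisenstein) (r theta : R) (k : nat).
Hypothesis prime_p : eprime p.
Hypothesis r_pos : 0 < r.
Hypothesis toC_p : toC p = (RtoC r * cis theta)%C.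

Lemma INR_norm_pow_sqr : INR (norm_pow p k) = (r ^ k) ^ 2.
Proof.
  rewrite INR_norm_pow, <- Cmod_toC_sqr, toC_p, Cmod_mult, Cmod_R, Cmod_cis.
  rewrite Rabs_pos_eq, Rmult_1_r, <- !pow_mult by lra. f_equal. lia.
Qed.

Lemma toC_prime_powers a b :
  toC (p ^ a * econj p ^ b) = (RtoC (r ^ (a + b)) * cis ((INR a - INR b) * theta))%C.
Proof.
  assert (toC (econj p) = RtoC r * cis (- theta))%C as Hc.
  { rewrite toC_conj, toC_p, Cmult_conj, cis_conj. f_equal.
    unfold Cconj, RtoC; simpl. f_equal. ring. }
  rewrite toC_mul, !toC_pow, Hc, toC_p, !Cpow_mult_l, !cis_pow, <- !RtoC_pow, pow_add, RtoC_mult.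
  replace ((INR a - INR b) * theta) with (INR a * theta + INR b * - theta) by ring.
  rewrite cis_plus. ring.
Qed.

Lemma exists_points_of_norm_pow : theta <> 0 -> 2 * (INR k * Rabs theta) <= PI ->
  exists l : list C, NoDup l /\ length l = S k /\
    forall mu, In mu l -> in_O mu /\ Cmod mu ^ 2 = INR (norm_pow p k).
Proof.
  intros Ht Hk. set (f := fun a => toC (p ^ a * econj p ^ (k - a))).
  assert (Hf : forall a, (a <= k)%nat ->
    f a = (RtoC (r ^ k) * cis ((2 * INR a - INR k) * theta))%C).
  { intros a Ha. unfold f. rewrite toC_prime_powers, minus_INR by auto.
    replace (a + (k - a))%nat with k by lia. do 3 f_equal. ring. }
  exists (map f (seq 0 (S k))). split; [|split].
  - apply NoDup_map_NoDup_ForallPairs; [|apply seq_NoDup]. intros a b Ha Hb E.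
    apply in_seq in Ha, Hb. rewrite !Hf in E by lia.
    apply (f_equal (Cmult (RtoC (/ r ^ k)))) in E.
    rewrite !Cmult_assoc, <- RtoC_mult, Rinv_l, !Cmult_1_l in E by (apply pow_nonzero; lra).
    apply cis_inj_near in E.
    + apply INR_eq, (Rmult_eq_reg_r theta); auto. lra.
    + replace ((2 * INR a - INR k) * theta - (2 * INR b - INR k) * theta)
        with (2 * ((INR a - INR b) * theta)) by ring.
      rewrite Rabs_mult, (Rabs_pos_eq 2), Rabs_mult by lra.
      eapply Rle_trans; [|exact Hk]. apply Rmult_le_compat_l; [lra|].
      apply Rmult_le_compat_r; [apply Rabs_pos|].
      assert (INR a <= INR k /\ INR b <= INR k) as [] by (split; apply le_INR; lia).
      pose proof (pos_INR a). pose proof (pos_INR b). apply Rabs_le. lra.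
  - rewrite length_map. apply length_seq.
  - intros mu Hmu. apply in_map_iff in Hmu as (a & <- & Ha). apply in_seq in Ha. split.
    + unfold f, toC, in_O. eauto.
    + rewrite Hf, Cmod_mult, Cmod_R, Cmod_cis, Rmult_1_r, pow2_abs, INR_norm_pow_sqr by lia.
      reflexivity.
Qed.

Lemma points_of_norm_pow_on_arcs eps mu : INR k * Rabs theta < eps ->
  in_O mu -> Cmod mu ^ 2 = INR (norm_pow p k) ->
  on_six_arcs eps (norm_pow p k) mu.
Proof.
  intros Heps (x & y & Hmu) Hn. change (mu = toC (x, y)) in Hmu. subst mu.
  rewrite Cmod_toC_sqr, INR_norm_pow, pow_IZR in Hn. apply eq_IZR in Hn.
  destruct (prime_power_enorm p k (x, y) prime_p Hn) as (u & a & b & Hu & Hab & ->).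
  destruct (toC_unit u Hu) as (nu & Hnu & Tu).
  exists nu. split; auto. exists ((INR a - INR b) * theta). split.
  - rewrite Rabs_mult. eapply Rle_lt_trans; [|apply Heps].
    apply Rmult_le_compat_r; [apply Rabs_pos|]. rewrite <- Hab, plus_INR.
    pose proof (pos_INR a). pose proof (pos_INR b). apply Rabs_le. lra.
  - rewrite INR_norm_pow_sqr, sqrt_pow2 by (apply pow_le; lra).
    rewrite toC_mul, toC_prime_powers, Tu, Hab, cis_plus. ring.
Qed.

End PrimePowerNorm.

Theorem theorem5p7 :
  forall (eps : R), 0 < eps -> forall k : nat,
  exists n : nat,
    (exists l : list C, NoDup l /\ (k < length l)%nat /\
       forall mu, In mu l -> in_O mu /\ (Cmod mu) ^ 2 = INR n) /\
    (forall mu : C, in_O mu -> (Cmod mu) ^ 2 = INR n -> on_six_arcs eps n mu).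
Proof.
  intros eps Heps k. pose proof (pos_INR k) as Hk. pose proof PI2_1.
  pose proof (Rmin_l eps 1). pose proof (Rmin_r eps 1).
  assert (0 < Rmin eps 1) as Hm by (apply Rmin_glb_lt; lra).
  destruct (exists_prime_small_arg (Rmin eps 1 / (INR k + 1)))
    as (p & r & theta & Hp & Hr & Ht & Hpos & Hsmall); [apply Rdiv_lt_0_compat; lra|].
  apply (Rmult_lt_compat_r (INR k + 1)) in Hsmall; [|lra].
  unfold Rdiv in Hsmall. rewrite Rmult_assoc, Rinv_l in Hsmall by lra.
  exists (norm_pow p k). split.
  - destruct (exists_points_of_norm_pow p r theta k) as (l & Nl & length_l & Hl); auto.
    + intros ->. rewrite Rabs_R0 in Hpos. lra.
    + lra.
    + exists l. rewrite length_l. auto.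
  - intros mu Hmu Hn. apply (points_of_norm_pow_on_arcs p r theta k); auto. lra.
Qed.
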